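(* Let $R$ be a Gorenstein local ring and let $M$ be a finitely generated $R$-module. Then $[M]$ is a torsion element of the $\mathbb{Z}[t^{\pm1}]$-module $J(R)$ if and only if $M$ is eventually periodic. Moreover, for any integer $n\geq1$, the following conditions are equivalent: (1) $(t^n-1)[M]=0$ in $J(R)$; (2) $\Omega^{\ell}M\cong\Omega^{n+\ell}M$ for all $\ell\gg0$.
   Context: All rings are commutative and Noetherian. $\mathcal{C}(R)$ is the set of isomorphism classes of finitely generated $R$-modules and $[M]$ is the class of $M$. Definition of $J(R)$: let $F=\bigoplus_{[M]\in\mathcal{C}(R)}\mathbb{Z}[t^{\pm1}][M]$ be the free $\mathbb{Z}[t^{\pm1}]$-module on $\mathcal{C}(R)$, where $\mathbb{Z}[t^{\pm1}]$ is the ring of Laurent polynomials, and let $I$ be the submodule generated by: (R1) $[M]-[M']$ for every exact sequence $0\to P\to M\to M'\to0$ of finitely generated $R$-modules with $P$ projective; (R2) $[M]-t[M']$ for every exact sequence $0\to M'\to P\to M\to0$ of finitely generated $R$-modules with $P$ projective; (R3) $[M\oplus M']-[M]-[M']$ for all finitely generated $M,M'$. Then $J(R)=F/I$; the image of $[M]$ in $J(R)$ is again written $[M]$. An element $u$ of a $\mathbb{Z}[t^{\pm1}]$-module is torsion if $ru=0$ for some non-zero $r\in\mathbb{Z}[t^{\pm1}]$. Over a local ring $R$, $\Omega M$ is the kernel of a surjection $R^m\to M$ with $m$ the minimal number of generators of $M$ (unique up to isomorphism), $\Omega^0M=M$ and $\Omega^iM=\Omega(\Omega^{i-1}M)$ for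 $i\geq1$. The module $M$ is eventually periodic if there exist integers $n\geq1$ and $\ell\geq0$ with $\Omega^{\ell}M\cong\Omega^{n+\ell}M$. *)

(* Defs.v *)
From HB Require Import structures.
From mathcomp Require Import all_boot all_algebra.
From mathcomp Require Import boolp classical_sets.
From mathcomp Require Import monalg.
Set Implicit Arguments.
Unset Strict Implicit.
Unset Printing Implicit Defensive.
Import GRing.Theory.
Local Open Scope classical_set_scope.
Local Open Scope quotient_scope.
Local Open Scope ring_scope.

Section Submodules.
Variables (A : comNzRingType) (V : lmodType A).

Definition is_submodule (N : set V) : Prop :=
  N 0 /\ forall (a : A) (x y : V), N x -> N y -> N (a *: x + y).

Definition span (S : set V) : set V :=
  [set x | forall N : set V, is_submodule N -> S `<=` N -> N x].

Lemma span_submodule (S : set V) : is_submodule (span S).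
Proof.
split=> [N [N0 _] _ //|a x y Sx Sy N hN SN].
by case: (hN) => _; apply; [apply: Sx|apply: Sy].
Qed.

Lemma sub_span (S : set V) : S `<=` span S.
Proof. by move=> x Sx N _; apply. Qed.

Lemma submoduleD (N : set V) x y :
  is_submodule N -> N x -> N y -> N (x + y).
Proof. by case=> _ hN Nx Ny; rewrite -[x]scale1r; apply: hN. Qed.

Lemma submoduleZ (N : set V) a x : is_submodule N -> N x -> N (a *: x).
Proof. by case=> N0 hN Nx; rewrite -[_ *: _]addr0; apply: hN. Qed.

Lemma submoduleN (N : set V) x : is_submodule N -> N x -> N (- x).
Proof. by rewrite -scaleN1r; apply: submoduleZ. Qed.

End Submodules.

(* The quotient module V / span S. *)
Section QuotientModule.
Variables (A : comNzRingType) (V : lmodType A) (S : set V).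

Definition quot_rel (x y : V) : bool := `[< span S (x - y) >].

Let sS := span_submodule S.

Fact quot_rel_refl : reflexive quot_rel.
Proof. by move=> x; apply/asboolP; rewrite subrr; case: sS. Qed.

Fact quot_rel_sym : symmetric quot_rel.
Proof.
move=> x y; apply/asboolP/asboolP => h; rewrite -opprB;
  exact: (submoduleN sS h).
Qed.

Fact quot_rel_trans : transitive quot_rel.
Proof.
move=> y x z /asboolP hxy /asboolP hyz; apply/asboolP.
by rewrite -(subrKA y); apply: (submoduleD sS).
Qed.

Definition quot_equiv :=
  EquivRel quot_rel quot_rel_refl quot_rel_sym quot_rel_trans.

Definition quot_module := {eq_quot quot_equiv}.
HB.instance Definition _ := Choice.on quot_module.
HB.instance Definition _ := EqQuotient.on quot_module.

Lemma quot_moduleP (x y : V) :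
  \pi_quot_module x = \pi_quot_module y <-> span S (x - y).
Proof. by split=> [/eqmodP/asboolP|h]; last exact/eqmodP/asboolP. Qed.

Definition quot_pi (x : V) : quot_module := \pi_quot_module x.

Let zero : quot_module := quot_pi 0.
Let opp (u : quot_module) : quot_module := quot_pi (- repr u).
Let add (u v : quot_module) : quot_module := quot_pi (repr u + repr v).
Let scale (a : A) (u : quot_module) : quot_module := quot_pi (a *: repr u).

Let quot_piK (u : quot_module) : quot_pi (repr u) = u.
Proof. exact: reprK. Qed.

Let repr_pi (x : V) : span S (repr (quot_pi x) - x).
Proof. by apply/quot_moduleP; rewrite reprK. Qed.

Let pi_opp (x : V) : opp (quot_pi x) = quot_pi (- x).
Proof.
by apply/quot_moduleP; rewrite -opprD; exact: (submoduleN sS (repr_pi x)).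
Qed.

Let pi_add (x y : V) : add (quot_pi x) (quot_pi y) = quot_pi (x + y).
Proof.
by apply/quot_moduleP; rewrite opprD addrACA;
  exact: (submoduleD sS (repr_pi x) (repr_pi y)).
Qed.

Let pi_scale (a : A) (x : V) : scale a (quot_pi x) = quot_pi (a *: x).
Proof.
by apply/quot_moduleP; rewrite -scalerBr;
  exact: (submoduleZ a sS (repr_pi x)).
Qed.

Fact quot_addA : associative add.
Proof.
move=> u v w; rewrite -(quot_piK u) -(quot_piK v) -(quot_piK w).
by rewrite !pi_add addrA.
Qed.

Fact quot_addC : commutative add.
Proof. by move=> u v; rewrite -(quot_piK u) -(quot_piK v) !pi_add addrC. Qed.

Fact quot_add0 : left_id zero add.
Proof. by move=> u; rewrite -(quot_piK u) pi_add add0r. Qed.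

Fact quot_addN : left_inverse zero opp add.
Proof. by move=> u; rewrite -(quot_piK u) pi_opp pi_add addNr. Qed.

HB.instance Definition _ :=
  GRing.isZmodule.Build quot_module quot_addA quot_addC quot_add0 quot_addN.

Fact quot_scaleA a b u : scale a (scale b u) = scale (a * b) u.
Proof. by rewrite -(quot_piK u) !pi_scale scalerA. Qed.

Fact quot_scale1 : left_id 1 scale.
Proof. by move=> u; rewrite -(quot_piK u) pi_scale scale1r. Qed.

Fact quot_scaleDr : right_distributive scale +%R.
Proof.
move=> a u v; rewrite -(quot_piK u) -(quot_piK v).
by rewrite [_ + _]pi_add !pi_scale [RHS]pi_add scalerDr.
Qed.

Fact quot_scaleDl u : {morph scale^~ u : a b / a + b}.
Proof.
by move=> a b; rewrite -(quot_piK u) !pi_scale [RHS]pi_add scalerDl.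
Qed.

HB.instance Definition _ := GRing.Zmodule_isLmodule.Build A quot_module
  quot_scaleA quot_scale1 quot_scaleDr quot_scaleDl.

Fact quot_pi_linear : linear quot_pi.
Proof. by move=> a x y; rewrite -pi_add -pi_scale. Qed.

HB.instance Definition _ :=
  GRing.isLinear.Build A V quot_module *:%R quot_pi quot_pi_linear.

Lemma quot_pi_eq0 (x : V) : quot_pi x = 0 <-> span S x.
Proof. by rewrite -[x in span _ x]subr0; apply: quot_moduleP. Qed.

Lemma quot_pi_surj (u : quot_module) : exists x, quot_pi x = u.
Proof. by exists (repr u); apply: reprK. Qed.

End QuotientModule.

Section Modules.
Variable R : comNzRingType.
Implicit Types M N P Q : lmodType R.

Definition surjective M N (f : M -> N) : Prop := forall y, exists x, f x = y.

Definition isomorphic M N : Prop := exists f : {linear M -> N}, bijective f.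

Definition short_exact M N P : Prop :=
  exists (f : {linear M -> N}) (g : {linear N -> P}),
    [/\ injective f, (forall y, g y = 0 <-> exists x, f x = y)
      & surjective g].

Definition projective P : Prop :=
  forall M N (g : {linear M -> N}) (f : {linear P -> N}), surjective g ->
    exists h : {linear P -> M}, forall x, g (h x) = f x.

Definition injective_module Q : Prop :=
  forall M N (i : {linear M -> N}) (f : {linear M -> Q}), injective i ->
    exists h : {linear N -> Q}, forall x, h (i x) = f x.

(* There is an injective resolution 0 -> M -> E 0 -> E 1 -> ... in which
   E i = 0 for i > n for some n. *)
Definition finite_injective_dimension M : Prop :=
  exists (E : nat -> lmodType R) (eps : {linear M -> E 0%N})
         (d : forall i, {linear E i -> E i.+1}) (n : nat),
    [/\ forall i, injective_module (E i),
        injective eps,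
        forall y, d 0%N y = 0 <-> exists x, eps x = y,
        forall i y, d i.+1 y = 0 <-> exists x, d i x = y
      & forall i, (n < i)%N -> forall y : E i, y = 0].

Definition generated_by (n : nat) M : Prop :=
  exists v : 'I_n -> M, span (range v) = setT.

Definition finitely_generated M : Prop := exists n, generated_by n M.

End Modules.

Section Rings.
Variable R : comNzRingType.

Definition is_ideal (I : set R) : Prop := is_submodule (I : set R^o).

Definition noetherian : Prop :=
  forall I : set R, is_ideal I ->
    exists (n : nat) (v : 'I_n -> R^o), I = span (range v).

Definition maximal_ideal (m : set R) : Prop :=
  [/\ is_ideal m, ~ m 1
    & forall I : set R, is_ideal I -> ~ I 1 -> m `<=` I -> I = m].

Definition local_ring : Prop := exists! m : set R, maximal_ideal m.

Definition gorenstein_local : Prop :=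
  [/\ noetherian, local_ring & finite_injective_dimension (R^o : lmodType R)].

End Rings.

Record fgModule (R : comNzRingType) := FgModule {
  fg_sort :> lmodType R;
  fg_sortP : finitely_generated fg_sort
}.

Lemma finitely_generated_pair (R : comNzRingType) (M N : lmodType R) :
  finitely_generated M -> finitely_generated N ->
  finitely_generated (M * N)%type.
Proof.
move=> [m [v hv]] [n [w hw]]; exists (m + n)%N.
exists (fun i =>
  match split i with inl j => (v j, 0) | inr k => (0, w k) end).
apply/seteqP; split=> // -[x y] _ K hK sK.
have -> : (x, y) = (x, 0) + (0, y) :> M * N.
  by congr pair; rewrite /= ?addr0 ?add0r.
apply: (submoduleD hK).
- have: span (range v) x by rewrite hv.
  move/(_ [set z | K (z, 0)]); apply=> [|_ [i _ <-]]; last first.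
    have e : split (lshift n i) = inl i := unsplitK (inl i).
    by apply: sK; exists (lshift n i) => //; rewrite e.
  split=> [|a z z' Kz Kz']; first by case: hK.
  rewrite /=; have -> : (a *: z + z', 0) = a *: (z, 0) + (z', 0) :> M * N.
    by congr pair; rewrite /= scaler0 addr0.
  by case: hK => _; apply.
- have: span (range w) y by rewrite hw.
  move/(_ [set z | K (0, z)]); apply=> [|_ [i _ <-]]; last first.
    have e : split (rshift m i) = inr i := unsplitK (inr i).
    by apply: sK; exists (rshift m i) => //; rewrite e.
  split=> [|a z z' Kz Kz']; first by case: hK.
  rewrite /=; have -> : (0, a *: z + z') = a *: (0, z) + (0, z') :> M * N.
    by congr pair; rewrite /= scaler0 addr0.
  by case: hK => _; apply.
Qed.

Definition fg_sum (R : comNzRingType) (M N : fgModule R) : fgModule R :=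
  @FgModule R (M * N)%type (finitely_generated_pair (fg_sortP M) (fg_sortP N)).

Section FreeCover.
Variables (R : comNzRingType) (M : lmodType R) (n : nat) (v : 'I_n -> M).

Definition free_cover (c : 'rV[R]_n) : M := \sum_i c 0 i *: v i.

Fact free_cover_linear : linear free_cover.
Proof.
move=> a c c'; rewrite /free_cover scaler_sumr -big_split /=.
by apply: eq_bigr => i _; rewrite !mxE scalerDl scalerA.
Qed.

HB.instance Definition _ :=
  GRing.isLinear.Build R 'rV[R]_n M *:%R free_cover free_cover_linear.

Lemma free_cover_surj : span (range v) = setT -> surjective free_cover.
Proof.
move=> hv y; have: span (range v) y by rewrite hv.
move/(_ [set z | exists x, free_cover x = z]); apply=> [|_ [i _ <-]].
  split=> [|a _ _ [c <-] [c' <-]]; first by exists 0; rewrite linear0.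
  by exists (a *: c + c'); rewrite linearP.
exists (delta_mx 0 i); rewrite /free_cover (bigD1 i) //= big1 => [|j ji].
  by rewrite mxE !eqxx scale1r addr0.
by rewrite mxE (negPf ji) andbF scale0r.
Qed.

End FreeCover.

Lemma finitely_generated_cover (R : comNzRingType) (n : nat) (M : lmodType R) :
  generated_by n M -> exists f : {linear 'rV[R]_n -> M}, surjective f.
Proof. by case=> v hv; exists (free_cover v); apply: free_cover_surj. Qed.

(* The set C(R) of isomorphism classes of finitely generated R-modules.  The
   type [fgModule R] lives one universe above the carriers allowed in a
   [lmodType], so no free module can be built on it.  Instead, the class of M is
   encoded by the set of all pairs (n, K) such that K is the kernel of a
   surjection R^n -> M; by [isoclassP] two modules have the same class iff they
   are isomorphic, and by [isoclass_surj] every element of C(R) is a class. *)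
Section IsoClasses.
Variable R : comNzRingType.

Definition presentation := {n : nat & set 'rV[R]_n}.

Definition presentations (M : lmodType R) : set presentation :=
  [set p | exists f : {linear 'rV[R]_(projT1 p) -> M},
     surjective f /\ projT2 p = [set x | f x = 0]].

Definition isoclasses : set (set presentation) :=
  [set c | exists2 M : lmodType R, finitely_generated M & presentations M = c].

Fact isoclass_subproof (M : fgModule R) : presentations M \in isoclasses.
Proof. by apply/mem_set; exists (fg_sort M) => //; apply: fg_sortP. Qed.

Definition isoclass (M : fgModule R) : isoclasses :=
  exist _ (presentations M) (isoclass_subproof M).

Lemma isoclass_surj (c : isoclasses) : exists M, isoclass M = c.
Proof.
case: c => c hc; have /set_mem [M hM Mc] := hc.
by exists (FgModule hM); apply: val_inj.
Qed.

Lemma isoclassP (M N : fgModule R) :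
  isoclass M = isoclass N <-> isomorphic M N.
Proof.
split=> [/(congr1 val)/= eMN|[f [g fK gK]]]; last first.
  apply: val_inj; apply/seteqP; split=> -[n K] [h [sh hK]].
    exists (f \o h); split=> [y|].
      by have [x hx] := sh (g y); exists x; rewrite /= hx gK.
    rewrite hK; apply/seteqP; split=> x /=; first by move=> ->; rewrite linear0.
    by move=> fhx; apply: (can_inj fK); rewrite fhx linear0.
  have lg : linear g.
    by move=> a x y; apply: (can_inj fK); rewrite linearP !gK.
  pose gL : {linear N -> M} := HB.pack g (GRing.isLinear.Build _ _ _ _ g lg).
  exists (gL \o h); split=> [y|].
    by have [x hx] := sh (f y); exists x; rewrite /= hx fK.
  rewrite hK; apply/seteqP; split=> x /=.
    by move=> ->; apply: (linear0 gL).
  by move=> ghx; apply: (can_inj gK); rewrite ghx; apply/esym/(linear0 gL).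
have [n gM] := fg_sortP M; have [f sf] := finitely_generated_cover gM.
have : presentations N (existT _ n [set x | f x = 0]).
  by rewrite -eMN; exists f.
case=> /= g [sg kfg].
have ker x : f x = 0 <-> g x = 0.
  by split=> h; move: (kfg) => /(congr1 (@^~ x))/=; rewrite h; [move<-|move->].
pose s y := projT1 (cid (sf y)); have sK y : f (s y) = y := projT2 (cid (sf y)).
pose r y := projT1 (cid (sg y)); have rK y : g (r y) = y := projT2 (cid (sg y)).
have fg x y : f x = f y <-> g x = g y.
  split=> /eqP; rewrite -subr_eq0 -linearB => /eqP/ker/eqP;
    by rewrite linearB subr_eq0 => /eqP.
have lh : linear (g \o s).
  move=> a x y /=; rewrite -linearP; apply/fg.
  by rewrite linearP !sK.
pose h : {linear M -> N} :=
  HB.pack (g \o s) (GRing.isLinear.Build _ _ _ _ (g \o s) lh).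
exists h.
exists (f \o r) => y /=; last by rewrite -[RHS]rK; apply/fg; rewrite sK.
by rewrite -[RHS]sK; apply/fg; rewrite rK.
Qed.

End IsoClasses.

Arguments isoclasses : clear implicits.

Local Notation "p %:F" := (tofrac p).

(* Laurent polynomials Z[t, 1/t], as the subring of the fraction field of Z[X]
   formed by the fractions p / X^k. *)
Definition laurent_pred : {pred {fraction {poly int}}} :=
  fun x => `[< exists (p : {poly int}) (k : nat), x = p%:F / ('X^k)%:F >].

Fact laurent_subring_closed : subring_closed laurent_pred.
Proof.
have Xn0 k : ('X^k : {poly int})%:F != 0.
  by rewrite tofrac_eq0 expf_neq0 ?polyX_eq0.
split=> [|x y|x y].
- by apply/asboolP; exists 1, 0%N; rewrite expr0 tofrac1 divr1.
- move=> /asboolP[p [k ->]] /asboolP[q [l ->]]; apply/asboolP.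
  exists (p * 'X^l - q * 'X^k), (k + l)%N.
  by rewrite exprD tofracB !tofracM -mulNr addf_div // mulNr.
- move=> /asboolP[p [k ->]] /asboolP[q [l ->]]; apply/asboolP.
  by exists (p * q), (k + l)%N; rewrite exprD !tofracM mulf_div.
Qed.

HB.instance Definition _ :=
  GRing.isSubringClosed.Build {fraction {poly int}} laurent_pred
    laurent_subring_closed.

Definition laurent := {x : {fraction {poly int}} | x \in laurent_pred}.
HB.instance Definition _ := SubChoice.on laurent.
HB.instance Definition _ :=
  [SubChoice_isSubComNzRing of laurent by <:].

Fact laurent_t_subproof : ('X : {poly int})%:F \in laurent_pred.
Proof. by apply/asboolP; exists 'X, 0%N; rewrite expr0 tofrac1 divr1. Qed.

Definition laurent_t : laurent :=
  exist _ ('X : {poly int})%:F laurent_t_subproof.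

Lemma laurent_t_inv : exists u : laurent, u * laurent_t = 1.
Proof.
have Xin : 1%:F / ('X : {poly int})%:F \in laurent_pred.
  by apply/asboolP; exists 1, 1%N; rewrite expr1.
exists (exist _ (1%:F / ('X : {poly int})%:F) Xin); apply: val_inj => /=.
by rewrite tofrac1 mul1r mulVf ?tofrac_eq0 ?polyX_eq0.
Qed.

Section J.
Variable R : comNzRingType.

Definition J_free := {malg laurent[isoclasses R]}.

Definition gen (M : fgModule R) : J_free := << isoclass M >>.

Inductive J_relation : J_free -> Prop :=
| J_R1 (P M M' : fgModule R) of projective P & short_exact P M M' :
    J_relation (gen M - gen M')
| J_R2 (P M M' : fgModule R) of projective P & short_exact M' P M :
    J_relation (gen M - laurent_t *: gen M')
| J_R3 (M M' : fgModule R) :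
    J_relation (gen (fg_sum M M') - gen M - gen M').

Definition J : lmodType laurent := quot_module (J_relation : set J_free).

Definition J_class (M : fgModule R) : J := quot_pi J_relation (gen M).

End J.

Definition torsion (V : lmodType laurent) (u : V) : Prop :=
  exists r : laurent, r != 0 /\ r *: u = 0.

Section Kernel.
Variables (R : comNzRingType) (U V : lmodType R) (f : {linear U -> V}).

Definition ker_pred : {pred U} := fun x => f x == 0.

Fact ker_submod_closed : submod_closed ker_pred.
Proof.
split=> [|a x y]; first by rewrite unfold_in linear0.
by rewrite !unfold_in linearP => /eqP-> /eqP->; rewrite scaler0 addr0.
Qed.

HB.instance Definition _ :=
  GRing.isSubmodClosed.Build R U ker_pred ker_submod_closed.

Definition kernel := {x : U | x \in ker_pred}.
HB.instance Definition _ := SubChoice.on kernel.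
HB.instance Definition _ := [SubChoice_isSubLmodule of kernel by <:].

End Kernel.

Section Syzygies.
Variable R : comNzRingType.
Implicit Type M : lmodType R.

(* A surjection R^m -> M, where m is the minimal number of generators of M. *)
Definition is_minimal_cover M (c : {m : nat & {linear 'rV[R]_m -> M}}) : Prop :=
  surjective (projT2 c) /\ forall n, generated_by n M -> (projT1 c <= n)%N.

(* A chosen minimal cover; the last branch is reached only if M is not finitely
   generated. *)
Definition minimal_cover M : {m : nat & {linear 'rV[R]_m -> M}} :=
  if pselect (exists c, is_minimal_cover (M := M) c) is left ex
  then projT1 (cid ex) else existT _ 0%N (\0 : {linear 'rV[R]_0 -> M}).

Lemma minimal_coverP M :
  finitely_generated M -> is_minimal_cover (minimal_cover M).
Proof.
move=> fgM; rewrite /minimal_cover; case: pselect => [ex|[]].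
  exact: (projT2 (cid ex)).
have ex : exists n, `[< generated_by n M >].
  by case: fgM => n hn; exists n; apply/asboolP.
case: (ex_minnP ex) => m /asboolP gm min_m.
have [f sf] := finitely_generated_cover gm; exists (existT _ m f).
split=> // n gn.
by apply: min_m; apply/asboolP.
Qed.

Definition syzygy M : lmodType R := kernel (projT2 (minimal_cover M)).

Definition syzygy_iter (i : nat) M : lmodType R := iter i syzygy M.

Definition eventually_periodic M : Prop :=
  exists n l : nat,
    (1 <= n)%N /\ isomorphic (syzygy_iter l M) (syzygy_iter (n + l) M).

End Syzygies.

(* Main.v *)
From HB Require Import structures.
From mathcomp Require Import all_boot all_algebra.
From mathcomp Require Import boolp classical_sets functions.
From mathcomp Require Import finmap monalg zify.
Require Import Defs.
Set Implicit Arguments.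
Unset Strict Implicit.
Unset Printing Implicit Defensive.
Import GRing.Theory.
Local Open Scope ring_scope.

(** The relation [J_R2] gives [[M] = t [Omega M]], so an isomorphism between
[Omega^l M] and [Omega^(n+l) M] immediately yields [(t^n - 1) [M] = 0]. The
converse directions need invariants of modules that satisfy the relations of
[J R] and still determine modules up to isomorphism.

These invariants are Krull-Schmidt multiplicities. Idempotents need not lift over
a local ring that is not Henselian, so finitely generated modules need not have
unique decompositions. They acquire them in the idempotent completion of the
category of modules modulo its Jacobson radical. That category is semisimple in
the sense of [fgcat_regular] and [fgcat_dcc]; both are proved by Noetherian
arguments. An object there that cannot be decomposed is given by a minimal
idempotent [e], the multiplicity [mult e M] is additive ([mult_biproduct]), and
[M] is a direct summand of [N] as soon as no multiplicity of [M] exceeds that of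
[N] ([mult_le_summand]). Isomorphisms lift along the radical, so equal
multiplicities imply isomorphism ([mult_eq_isomorphic]).

For [e] that is not a summand of a free module, multiplicities are invariants of
the stable category, and by versions of Schanuel's lemma the sequences
[l |-> mult e (Omega^l M)] satisfy the relations of [J R] from [l = 1] on, with
[t] acting as a shift. An equation [r [M] = 0] in [J R] is thus a linear
recurrence for these sequences, valid from an index that is the same for all [e]
([J_class_annihilated]). Finite injective dimension makes [Ext^1 (-, R)] vanish
on high syzygies, so they have no free summands and the excluded [e] do not occur
in them ([gorenstein_syzygies], [mult_no_unit_form]). For [r = t^n - 1] the
recurrence says that [Omega^l M] and [Omega^(n+l) M] have the same multiplicities,
hence are isomorphic, for all large [l] ([annihilated_period]).

For general non-zero [r] the recurrence confines the indecomposable constituents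
of all [Omega^l M] to a finite list, and Dickson's lemma produces [i < j] such
that [Omega^i M] is a direct summand of [Omega^j M]. A complement would persist:
by the vanishing of [Ext^1 (-, R)] orthogonal idempotents of a high syzygy
[Omega K] descend to [K] modulo radicals ([orth_family_desuspension]), so the
number of constituents cannot grow with [l], and [Omega^i M] is isomorphic to
[Omega^j M] ([annihilated_periodic]). This step is where the Gorenstein condition
is essential: over a ring with [m^2 = 0] that is not Gorenstein, the syzygies of
the residue field are ever larger powers of it, so its class is torsion although
it is not eventually periodic. *)

Lemma dependent_choice (T : Type) (P : T -> Prop) (r : T -> T -> Prop) (x0 : T) :
  P x0 -> (forall x, P x -> exists2 y, P y & r x y) ->
  exists u : nat -> T, u 0%N = x0 /\ forall n, P (u n) /\ r (u n) (u n.+1).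
Proof.
move=> Px0 step.
have stepS (x : {x | P x}) : exists y : {x | P x}, r (sval x) (sval y).
  by case: x => x /step[y Py xy] /=; exists (exist _ y Py).
pose next x := sval (cid (stepS x)).
exists (fun n => sval (iter n next (exist _ x0 Px0))); split=> // n.
by split; [apply: svalP|rewrite /= /next; case: cid].
Qed.

(** * Minimal idempotents in preadditive categories *)

(** Equality of morphisms is Leibniz equality, so that categories of modules modulo
an ideal of morphisms are instances. *)
Record preadditive := Preadditive {
  ob :> Type;
  hm : ob -> ob -> zmodType;
  idm : forall a, hm a a;
  cmp : forall a b c, hm b c -> hm a b -> hm a c;
  cmpA : forall a b c d (f : hm c d) (g : hm b c) (h : hm a b),
    cmp f (cmp g h) = cmp (cmp f g) h;
  cmp1m : forall a b (f : hm a b), cmp (idm b) f = f;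
  cmpm1 : forall a b (f : hm a b), cmp f (idm a) = f;
  cmpDl : forall a b c (f g : hm b c) (h : hm a b),
    cmp (f + g) h = cmp f h + cmp g h;
  cmpDr : forall a b c (f : hm b c) (g h : hm a b),
    cmp f (g + h) = cmp f g + cmp f h
}.

Arguments idm {p} a.
Declare Scope cmp_scope.
Delimit Scope cmp_scope with cmp.
Notation "f ** g" := (cmp f g) (at level 39, left associativity) : cmp_scope.
Local Open Scope cmp_scope.

Section Bilinear.
Variable C : preadditive.
Implicit Types a b c : C.

Lemma cmp0m a b c (h : hm a b) : (0 : hm b c) ** h = 0.
Proof. by apply: (addrI (0 ** h)); rewrite -cmpDl !addr0. Qed.

Lemma cmpm0 a b c (f : hm b c) : f ** (0 : hm a b) = 0.
Proof. by apply: (addrI (f ** 0)); rewrite -cmpDr !addr0. Qed.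

Lemma cmpNl a b c (f : hm b c) (h : hm a b) : (- f) ** h = - (f ** h).
Proof. by apply: (addrI (f ** h)); rewrite -cmpDl !subrr cmp0m. Qed.

Lemma cmpNr a b c (f : hm b c) (h : hm a b) : f ** (- h) = - (f ** h).
Proof. by apply: (addrI (f ** h)); rewrite -cmpDr !subrr cmpm0. Qed.

Lemma cmpBl a b c (f g : hm b c) (h : hm a b) : (f - g) ** h = f ** h - g ** h.
Proof. by rewrite cmpDl cmpNl. Qed.

Lemma cmpBr a b c (f : hm b c) (g h : hm a b) : f ** (g - h) = f ** g - f ** h.
Proof. by rewrite cmpDr cmpNr. Qed.

Lemma cmp_suml a b c (I : Type) (s : seq I) (P : pred I) (F : I -> hm b c)
    (h : hm a b) :
  (\sum_(i <- s | P i) F i) ** h = \sum_(i <- s | P i) F i ** h.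
Proof.
by apply: (big_morph (fun f => f ** h)) => [f g|]; rewrite ?cmpDl ?cmp0m.
Qed.

Lemma cmp_sumr a b c (I : Type) (s : seq I) (P : pred I) (F : I -> hm a b)
    (f : hm b c) :
  f ** (\sum_(i <- s | P i) F i) = \sum_(i <- s | P i) f ** F i.
Proof.
by apply: (big_morph (fun h => f ** h)) => [g h|]; rewrite ?cmpDr ?cmpm0.
Qed.

Definition idempotent a (e : hm a a) := e ** e = e.

(** Idempotents stand for the objects of the idempotent completion; a minimal
idempotent is an indecomposable object there. *)
Definition minimal a (e : hm a a) :=
  [/\ e != 0, idempotent e
    & forall d : hm a a, idempotent d -> e ** d = d -> d ** e = d ->
        d = 0 \/ d = e].

Definition orthogonal a n (e : nat -> hm a a) :=
  forall i j, (i < n)%N -> (j < n)%N -> e i ** e j = if i == j then e i else 0.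

End Bilinear.

(** The form in which semisimplicity is used: a non-zero morphism is invertible
on some non-zero direct summand of its source. *)
Definition quasi_regular (C : preadditive) :=
  forall (a b : C) (f : hm a b), f != 0 ->
    exists g : hm b a, idempotent (g ** f) /\ g ** f != 0.

Definition idempotent_dcc (C : preadditive) :=
  forall (a : C) (E : nat -> hm a a), (forall n, idempotent (E n)) ->
    (forall n, E n ** E n.+1 = E n.+1 /\ E n.+1 ** E n = E n.+1) ->
    exists n, E n.+1 = E n.

Lemma sum_neq0 (V : zmodType) (I : eqType) (s : seq I) (F : I -> V) :
  \sum_(i <- s) F i != 0 -> exists2 i, i \in s & F i != 0.
Proof.
move=> h; apply: contrapT => nex; move/eqP: h; apply.
rewrite big_seq big1 // => i si; apply/eqP; apply: contrapT => /negP Fi.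
by apply: nex; exists i.
Qed.

Section Semisimple.
Variable C : preadditive.
Hypothesis (C_reg : quasi_regular C) (C_dcc : idempotent_dcc C).
Implicit Types t x y : C.

(** Schur's lemma. Quasi-regularity gives an idempotent [g ** f], and
[e ** g ** f] is a non-zero idempotent below [e]. *)
Lemma minimal_linv (a b : C) (e : hm a a) (f : hm a b) :
  minimal e -> f ** e = f -> f != 0 -> exists w, w ** f = e /\ e ** w = w.
Proof.
move=> [e0 ee emin] fe /C_reg[g [gfi gf0]].
have feR c (z : hm b c) : z ** f ** e = z ** f by rewrite -cmpA fe.
have gfR c (z : hm a c) : z ** g ** f ** g ** f = z ** g ** f.
  by rewrite -!cmpA [g ** (f ** _)]cmpA gfi.
have di : idempotent (e ** g ** f) by rewrite /idempotent !cmpA feR gfR.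
case: (emin _ di) => [|||de]; first by rewrite !cmpA ee.
- exact: feR.
- move=> d0; case/eqP: gf0; rewrite -gfi cmpA -(feR _ (g)) -!cmpA.
  by rewrite [e ** _]cmpA d0 !cmpm0.
- by exists (e ** g); rewrite !cmpA ee.
Qed.

(** A non-zero morphism between two indecomposable objects is an isomorphism:
its left inverse is also a right inverse by minimality of [d]. *)
Lemma minimal_split (a b : C) (e : hm a a) (f : hm a b) (d : hm b b) :
  minimal e -> minimal d -> d ** f ** e != 0 ->
  exists w : hm b a, [/\ w ** (d ** f ** e) = e, e ** w = w,
    w ** d = w & d ** f ** e ** w = d].
Proof.
move=> me md f0; have [_ ee _] := me; have [_ dd dmin] := md.
have [|w [wf ew]] := minimal_linv me _ f0; first by rewrite -cmpA ee.
have ddR c (z : hm b c) : z ** d ** d = z ** d by rewrite -cmpA dd.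
have wfR c (z : hm a c) : z ** w ** d ** f ** e = z ** e.
  by rewrite -[in RHS]wf !cmpA.
have hi : idempotent (d ** f ** e ** w ** d).
  by rewrite /idempotent !cmpA ddR wfR -!cmpA [e ** (e ** _)]cmpA ee.
exists (w ** d); split=> //; first by rewrite !cmpA ddR -[RHS]wf !cmpA.
- by rewrite cmpA ew.
rewrite cmpA; case: (dmin _ hi) => //; first by rewrite !cmpA dd.
move=> h0; have [e0 _ _] := me; case/eqP: e0.
have -> : e = w ** (d ** f ** e ** w ** d) ** d ** f ** e.
  by rewrite !cmpA !ddR wfR -!cmpA ee -[LHS]wf !cmpA.
by rewrite h0 cmpm0 !cmp0m.
Qed.

(** Steinitz exchange, as Gaussian elimination: the hypothesis is a matrix
identity [A * e * B = diag eps] with one column of [A] for each index in [s]. The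
first row has a non-zero entry, that entry has a left inverse by Schur's lemma,
and eliminating its column removes one row and one index. *)
Lemma steinitz (I : eqType) t y (e : I -> hm y y) n (s : seq I)
    (A : nat -> I -> hm y t) (B : I -> nat -> hm t y) (eps : nat -> hm t t) :
  (forall i, i \in s -> minimal (e i)) ->
  (forall a, (a < n)%N -> eps a != 0) ->
  (forall a b, (a < n)%N -> (b < n)%N ->
     \sum_(i <- s) A a i ** e i ** B i b = if a == b then eps a else 0) ->
  (n <= size s)%N.
Proof.
elim: n s A B eps => [//|n IH] s A B eps mine eps0 AB.
have [|i si Fi] := @sum_neq0 _ _ s (fun i => A 0%N i ** e i ** B i 0%N).
  by rewrite AB //= eps0.
have [_ ee _] := mine i si.
have [||w [wf _]] := @minimal_linv _ _ (e i) (A 0%N i ** e i) (mine i si).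
- by rewrite -cmpA ee.
- by apply: contraNneq Fi => ->; rewrite cmp0m.
have s_gt0 : (0 < size s)%N by case: (s) si.
rewrite -(prednK s_gt0) ltnS -(size_rem si).
(* w inverts the pivot in column i, and column i is subtracted from the rest *)
apply: (IH (rem i s) (fun a k => A a.+1 k - A a.+1 i ** e i ** w ** A 0%N k)
           (fun k b => B k b.+1) (fun a => eps a.+1)).
- by move=> k /mem_rem; apply: mine.
- by move=> a an; apply: eps0.
move=> a b an bn.
have H c : (c < n.+1)%N ->
    \sum_(k <- rem i s) A c k ** e k ** B k b.+1 =
    (if c == b.+1 then eps c else 0) - A c i ** e i ** B i b.+1.
  by move=> cn; rewrite -(AB c b.+1) // (big_rem i si) /= addrAC subrr add0r.
under eq_bigr => k _ do
  rewrite cmpBl cmpBl -(cmpA _ (A 0%N k)) -(cmpA _ (A 0%N k ** _)).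
rewrite sumrB -cmp_sumr !H // sub0r cmpNr opprK !cmpA.
have -> : A a.+1 i ** e i ** w ** A 0%N i ** e i = A a.+1 i ** e i.
  by rewrite -!cmpA [w ** _]wf ee.
by rewrite subrK eqSS.
Qed.

Definition splits (a : C) (e : hm a a) n (d : nat -> hm a a) :=
  [/\ forall i, (i < n)%N -> minimal (d i), orthogonal n d
    & \sum_(0 <= i < n) d i = e].

Lemma splits_absorb (a : C) (e : hm a a) n d i :
  splits e n d -> (i < n)%N -> d i ** e = d i /\ e ** d i = d i.
Proof.
move=> [_ orth <-] ni; rewrite cmp_sumr cmp_suml.
have ii : i \in index_iota 0 n by rewrite mem_index_iota.
rewrite !(big_rem i ii) /= !orth // eqxx !big_seq !big1 ?addr0 // => j.
all: rewrite mem_rem_uniq ?iota_uniq // inE mem_index_iota => /andP[ji nj].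
- by rewrite orth // (negPf ji).
- by rewrite orth // eq_sym (negPf ji).
Qed.

Lemma splits_cat (a : C) (e e' : hm a a) n n' d d' :
  e ** e' = 0 -> e' ** e = 0 -> splits e n d -> splits e' n' d' ->
  splits (e + e') (n + n') (fun i => if (i < n)%N then d i else d' (i - n)%N).
Proof.
move=> ee' e'e sd sd'; have [mind orth sumd] := sd.
have [mind' orth' sumd'] := sd'.
have lt i : (i < n + n')%N -> (i < n)%N = false -> (i - n < n')%N.
  by move=> h /negbT; rewrite -leqNgt => ni; rewrite ltn_subLR.
split=> [i ni|i j ni nj|].
- by case: ifPn => h; [apply: mind|apply: mind'; apply: lt => //; apply: negPf].
- case hi: (i < n)%N; case hj: (j < n)%N; first exact: orth.
  + have -> : (i == j) = false by apply/eqP => ij; rewrite -ij hi in hj.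
    have [<- _] := splits_absorb sd hi.
    have [_ <-] := splits_absorb sd' (lt _ nj hj).
    by rewrite !cmpA -(cmpA _ e) ee' cmpm0 cmp0m.
  + have -> : (i == j) = false by apply/eqP => ij; rewrite ij hj in hi.
    have [<- _] := splits_absorb sd' (lt _ ni hi).
    have [_ <-] := splits_absorb sd hj.
    by rewrite !cmpA -(cmpA _ e') e'e cmpm0 cmp0m.
  + rewrite orth' ?lt // eqn_sub2rE //; first by rewrite leqNgt hi.
    by rewrite leqNgt hj.
rewrite (@big_cat_nat _ _ _ n) ?leq_addr //=; congr (_ + _).
  by rewrite -sumd; apply: eq_big_nat => i /= ->.
rewrite -{1}[n]add0n big_addn addKn -sumd'; apply: eq_big_nat => i _.
by rewrite ltnNge leq_addl addnK.
Qed.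

(** An idempotent with no decomposition is not minimal, and one of the two
halves of any splitting of it has no decomposition either; repeating this
contradicts the descending chain condition. *)
Lemma idempotent_splits (a : C) (e : hm a a) :
  idempotent e -> exists n d, splits e n d.
Proof.
pose bad (e : hm a a) := idempotent e /\ ~ exists n d, splits e n d.
have step e' : bad e' -> exists2 d, bad d
    & [/\ e' ** d = d, d ** e' = d & d <> e'].
  move=> be; have [ei nsp] := be.
  have e0 : e' != 0.
    apply/eqP => e0; apply: nsp; exists 0%N, (fun=> 0).
    by split=> //; rewrite big_geq.
  have nmin : ~ minimal e'.
    move=> me; apply: nsp; exists 1%N, (fun=> e').
    by split=> [//|[|//] [|//] _ _ /=|]; rewrite ?big_nat1.
  apply: contrapT => nex; apply: nmin; split=> // d di ed de.
  case: (pselect (d = 0)) => [|d0]; [by left|right].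
  apply: contrapT => nde.
  have fi : idempotent (e' - d).
    by rewrite /idempotent cmpBl !cmpBr ei ed de di subrr subr0.
  have bad_no f : idempotent f -> e' ** f = f -> f ** e' = f -> f <> e' ->
      exists n g, splits f n g.
    by move=> idf ef fe fne; apply: contrapT => nf; apply: nex; exists f.
  have [n [g sg]] := bad_no d di ed de nde.
  have [||||n' [g' sg']] := bad_no (e' - d) => //.
  - by rewrite cmpBr ei ed.
  - by rewrite cmpBl ei de.
  - by move=> h; apply: d0; apply: oppr_inj; rewrite oppr0; apply: (addrI e');
      rewrite addr0.
  apply: nsp; exists (n + n')%N; eexists.
  rewrite -[e'](subrKC d).
  apply: splits_cat sg sg'; first by rewrite cmpBr de di subrr.
  by rewrite cmpBl ed di subrr.
move=> ei; apply: contrapT => nsp.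
have [E [_ hE]] := dependent_choice (conj ei nsp : bad e) step.
have [||n] := C_dcc (E := E).
- by move=> n; have [[]] := hE n.
- by move=> n; have [_ []] := hE n.
- by have [_ []] := hE n.
Qed.

(** The images of the idempotents [eps 0], ..., [eps n.-1] together form a
direct summand of [y], embedded by [F] and projected onto by [G]. *)
Definition frame_by t (eps : nat -> hm t t) n y (F : nat -> hm t y)
    (G : nat -> hm y t) :=
  forall i j, (i < n)%N -> (j < n)%N ->
    eps i ** G i ** F j ** eps j = if i == j then eps i else 0.

Definition frame t (eps : nat -> hm t t) n y := exists F G, @frame_by t eps n y F G.

Section Residual.
Variables (t y : C) (eps : nat -> hm t t) (n : nat).
Variables (F : nat -> hm t y) (G : nat -> hm y t).
Hypothesis FG : frame_by eps n F G.

Definition residual := idm y - \sum_(0 <= i < n) F i ** eps i ** G i.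

Lemma residual_l i : (i < n)%N -> eps i ** G i ** residual = 0.
Proof.
move=> ni; rewrite cmpBr cmpm1 cmp_sumr.
have ii : i \in index_iota 0 n by rewrite mem_index_iota.
rewrite (big_rem i ii) /= !cmpA FG // eqxx big_seq big1 ?addr0 ?subrr // => j.
rewrite mem_rem_uniq ?iota_uniq // inE mem_index_iota => /andP[ji nj].
by rewrite !cmpA FG // eq_sym (negPf ji) cmp0m.
Qed.

Lemma residual_r i : (i < n)%N -> residual ** (F i ** eps i) = 0.
Proof.
move=> ni; rewrite cmpBl cmp1m cmp_suml.
have ii : i \in index_iota 0 n by rewrite mem_index_iota.
rewrite (big_rem i ii) /= -!cmpA [eps i ** _]cmpA [_ ** (F i ** _)]cmpA FG //.
rewrite eqxx big_seq big1 ?addr0 ?subrr // => j.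
rewrite mem_rem_uniq ?iota_uniq // inE mem_index_iota => /andP[ji nj].
by rewrite -!cmpA [eps j ** _]cmpA [_ ** (F i ** _)]cmpA FG // (negPf ji) cmpm0.
Qed.

Lemma residual_idem : idempotent residual.
Proof.
rewrite /idempotent {2}/residual cmpBr cmpm1 cmp_sumr big_nat big1 ?subr0 //.
by move=> i ni; rewrite cmpA residual_r // cmp0m.
Qed.

(** A non-zero composite of [eps n] through the complement of a frame can be
normalized to the identity of [eps n] by Schur's lemma, and passing through the
complement makes it orthogonal to the frame. *)
Lemma frame_extend (f : hm t y) (g : hm y t) :
  minimal (eps n) -> eps n ** g ** residual ** f ** eps n != 0 ->
  frame eps n.+1 y.
Proof.
move=> me h; have [_ ee _] := me.
have [|w [wu ew]] := minimal_linv me _ h; first by rewrite -cmpA ee.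
exists (fun i => if i == n then residual ** f else F i).
exists (fun i => if i == n then w ** eps n ** g ** residual else G i).
have lt i : (i < n.+1)%N -> (i == n) = false -> (i < n)%N.
  by rewrite ltnS leq_eqVlt => /orP[/eqP->|//]; rewrite eqxx.
move=> i j ni nj; case: (eqVneq i n) => [->|/negPf ei];
  case: (eqVneq j n) => [->|/negPf ej].
- rewrite !cmpA ew -(cmpA _ residual residual) residual_idem.
  by rewrite -[RHS]wu !cmpA.
- by rewrite -!cmpA residual_r ?lt // !cmpm0.
- by rewrite ei !cmpA residual_l ?lt // !cmp0m.
- by apply: FG; apply: lt.
Qed.

End Residual.

Lemma frame_le t (eps : nat -> hm t t) m n y :
  (m <= n)%N -> frame eps n y -> frame eps m y.
Proof.
move=> mn [F [G FG]]; exists F, G => i j im jm.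
by apply: FG; apply: leq_trans mn.
Qed.

Lemma frame_bound t (eps : nat -> hm t t) m y n d :
  splits (idm y) n d -> (forall i, (i < m)%N -> eps i != 0) ->
  frame eps m y -> (m <= n)%N.
Proof.
move=> [mind _ sumd] eps0 [F [G FG]].
have -> : n = size (index_iota 0 n) by rewrite size_iota subn0.
apply: (steinitz (e := d) (s := index_iota 0 n)
  (A := fun a _ => eps a ** G a) (B := fun _ b => F b ** eps b) (eps := eps)).
- by move=> i; rewrite mem_index_iota; apply: mind.
- exact: eps0.
- move=> a b am bm; rewrite -cmp_suml -cmp_sumr sumd cmpm1 cmpA.
  exact: FG.
Qed.

(** The Krull-Schmidt multiplicity of the indecomposable object [e] in [y]; the
default value never occurs, by [multP]. *)
Definition mult t (e : hm t t) y : nat :=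
  if pselect (exists n, frame (fun=> e) n y /\
    forall m, frame (fun=> e) m y -> (m <= n)%N) is left h
  then projT1 (cid h) else 0%N.

Lemma multP t (e : hm t t) y n :
  minimal e -> frame (fun=> e) n y <-> (n <= mult e y)%N.
Proof.
move=> me; rewrite /mult; case: pselect => [h|[]]; last first.
  have [m [d sd]] := idempotent_splits (cmp1m (idm y)).
  have ex : exists n, `[< frame (fun=> e) n y >] by
    exists 0%N; apply/asboolP; exists (fun=> 0), (fun=> 0).
  have ub k : `[< frame (fun=> e) k y >] -> (k <= m)%N.
    by move=> /asboolP; apply: frame_bound sd _ => i _; case: me.
  case: (ex_maxnP ex ub) => k /asboolP fk maxk; exists k; split=> // j fj.
  by apply: maxk; apply/asboolP.
case: cid => m [fm maxm] /=; split; first exact: maxm.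
by move=> nm; apply: frame_le fm.
Qed.

Lemma mult_residual t (e : hm t t) y F G (f : hm t y) (g : hm y t) :
  minimal e -> frame_by (fun=> e) (mult e y) F G ->
  e ** g ** residual (fun=> e) (mult e y) F G ** f ** e = 0.
Proof.
move=> me FG; apply/eqP; apply: contraT => h.
have [_ ee _] := me.
have : frame (fun=> e) (mult e y).+1 y.
  exact: (frame_extend FG me h).
by move/(multP _ _ me); rewrite ltnn.
Qed.

(** A maximal frame of copies of [e] carries every endomorphism of [e] that
factors through [y]. *)
Lemma mult_factor t (e : hm t t) y F G (f : hm t y) (g : hm y t) :
  minimal e -> frame_by (fun=> e) (mult e y) F G ->
  e ** g ** f ** e =
  \sum_(0 <= i < mult e y) e ** g ** F i ** e ** G i ** f ** e.
Proof.
move=> me FG; apply: subr0_eq; rewrite -[RHS](mult_residual f g me FG).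
rewrite cmpBr cmpm1 !cmpBl cmp_sumr !cmp_suml; congr (_ - _).
by apply: eq_bigr => i _; rewrite !cmpA.
Qed.

Definition is_biproduct x y z :=
  exists (i1 : hm x z) (i2 : hm y z) (p1 : hm z x) (p2 : hm z y),
    [/\ p1 ** i1 = idm x, p2 ** i2 = idm y, p1 ** i2 = 0, p2 ** i1 = 0
      & i1 ** p1 + i2 ** p2 = idm z].

(** The copies of [e] in a biproduct factor through those in the two summands,
so Steinitz exchange inside [e] itself bounds their number. *)
Lemma mult_biproduct t (e : hm t t) x y z :
  minimal e -> is_biproduct x y z -> mult e z = (mult e x + mult e y)%N.
Proof.
move=> me [i1 [i2 [p1 [p2 [p11 p22 p12 p21 ip]]]]]; have [_ ee _] := me.
have /(multP _ _ me)[F1 [G1 FG1]] := leqnn (mult e x).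
have /(multP _ _ me)[F2 [G2 FG2]] := leqnn (mult e y).
set m := mult e x in F1 G1 FG1 *; set n := mult e y in F2 G2 FG2 *.
apply/eqP; rewrite eqn_leq; apply/andP; split; last first.
  apply/multP => //.
  exists (fun i => if (i < m)%N then i1 ** F1 i else i2 ** F2 (i - m)%N).
  exists (fun i => if (i < m)%N then G1 i ** p1 else G2 (i - m)%N ** p2).
  have lt i : (i < m + n)%N -> (i < m)%N = false -> (i - m < n)%N.
    by move=> h /negbT; rewrite -leqNgt => ni; rewrite ltn_subLR.
  move=> i j ni nj; case hi: (i < m)%N; case hj: (j < m)%N; rewrite !cmpA.
  + by rewrite -(cmpA _ p1 i1) p11 cmpm1; apply: FG1.
  + rewrite -(cmpA _ p1 i2) p12 cmpm0 !cmp0m; case: eqP => // ij.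
    by rewrite -ij hi in hj.
  + rewrite -(cmpA _ p2 i1) p21 cmpm0 !cmp0m; case: eqP => // ij.
    by rewrite ij hj in hi.
  + rewrite -(cmpA _ p2 i2) p22 cmpm1 FG2 ?lt // eqn_sub2rE //.
      by rewrite leqNgt hi.
    by rewrite leqNgt hj.
have /(multP _ _ me)[F [G FG]] := leqnn (mult e z).
pose s : seq (nat + nat) :=
  map inl (index_iota 0 m) ++ map inr (index_iota 0 n).
have -> : (m + n)%N = size s by rewrite size_cat !size_map !size_iota !subn0.
pose A a (k : nat + nat) := match k with
  inl i => e ** G a ** i1 ** F1 i | inr i => e ** G a ** i2 ** F2 i end.
pose B (k : nat + nat) b := match k with
  inl i => G1 i ** p1 ** F b ** e | inr i => G2 i ** p2 ** F b ** e end.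
apply: (steinitz (e := fun=> e) (A := A) (B := B) (eps := fun=> e)) => //.
  by move=> a _; case: me.
move=> a b am bm; rewrite big_cat /= !big_map /A /B.
under eq_bigr do rewrite !cmpA -(cmpA _ (G a) i1).
under [in X in _ + X]eq_bigr do rewrite !cmpA -(cmpA _ (G a) i2).
under eq_bigr do rewrite -(cmpA _ p1 (F b)).
under [in X in _ + X]eq_bigr do rewrite -(cmpA _ p2 (F b)).
rewrite -!mult_factor // -FG // !cmpA -!cmpDl -!(cmpA (e ** G a)) -cmpDr.
by rewrite ip cmpm1 !cmpA.
Qed.

Lemma frame_transfer t t' (e : hm t t) (e' : hm t' t') (f : hm t t') n y :
  minimal e -> minimal e' -> e' ** f ** e != 0 ->
  frame (fun=> e) n y -> frame (fun=> e') n y.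
Proof.
move=> me me' fn0 [F [G FG]]; have [_ ee _] := me; have [_ ee' _] := me'.
have [w [we ew we' we'']] := minimal_split me me' fn0.
exists (fun i => F i ** w), (fun i => e' ** f ** e ** G i) => i j ni nj.
have h := FG i j ni nj.
rewrite !cmpA ee' -(cmpA _ w e') we' -ew.
have -> : e' ** f ** e ** G i ** F j ** (e ** w) =
          e' ** f ** (e ** G i ** F j ** e) ** w by rewrite !cmpA.
by rewrite h; case: ifP => _; rewrite ?cmpm0 ?cmp0m.
Qed.

Lemma mult_transfer t t' (e : hm t t) (e' : hm t' t') (f : hm t t') y :
  minimal e -> minimal e' -> e' ** f ** e != 0 -> mult e y = mult e' y.
Proof.
move=> me me' fn0; have [w [we ew we' we'']] := minimal_split me me' fn0.
apply/eqP; rewrite eqn_leq; apply/andP; split.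
  apply/multP => //; apply: frame_transfer fn0 _ => //.
  exact/multP.
apply/multP => //; apply: (@frame_transfer _ _ e' e w) => //.
  have [e0 _ _] := me; rewrite ew we'; apply: contraNneq e0 => w0.
  by rewrite -we w0 cmp0m.
exact/multP.
Qed.

Lemma mult_support t (e : hm t t) y n d :
  minimal e -> splits (idm y) n d -> mult e y != 0%N ->
  exists2 i, (i < n)%N & mult e =1 mult (d i).
Proof.
move=> me [mind _ sumd]; rewrite -lt0n => /(multP _ _ me)[F [G FG]].
have [e0 _ _] := me.
have [] := @sum_neq0 _ _ (index_iota 0 n)
  (fun i => e ** G 0%N ** d i ** F 0%N ** e).
  by rewrite -!cmp_suml -cmp_sumr sumd cmpm1 FG.
move=> i; rewrite mem_index_iota => ni h; exists i => // z; apply/esym.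
apply: (mult_transfer (f := e ** G 0%N)) => //; first exact: mind.
have [_ ee _] := me; rewrite cmpA ee.
by apply: contraNneq h => ->; rewrite !cmp0m.
Qed.

(** By Schur's lemma [s] lists the members of index below [q] that are isomorphic
to [d q]; together with [d q] itself they are as many copies of it in [x]. *)
Lemma frame_isotypic x (d : nat -> hm x x) n q :
  splits (idm x) n d -> (q < n)%N ->
  let s := [seq i <- index_iota 0 q | `[< exists f, d q ** f ** d i != 0 >]] in
  ((size s).+1 <= mult (d q) x)%N.
Proof.
move=> [mind orth sumd] qn; set s := [seq _ <- _ | _] => /=.
apply/multP; first exact: mind.
have mq : minimal (d q) by apply: mind.
pose s' := q :: s.
have s'P i : i \in s' -> (i < n)%N /\ exists f, d q ** f ** d i != 0.
  rewrite inE => /orP[/eqP->|].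
    by have [q0 qq _] := mq; split=> //; exists (d q); rewrite qq qq.
  rewrite mem_filter mem_index_iota => /andP[/asboolP h iq]; split=> //.
  exact: ltn_trans iq qn.
have us' : uniq s'.
  rewrite /= filter_uniq ?iota_uniq // andbT mem_filter mem_index_iota.
  by rewrite ltnn !andbF.
have /choice[f hf] : forall i, exists f, i \in s' -> d q ** f ** d i != 0.
  move=> i; case si: (i \in s'); last by exists 0.
  by have [_ [f hf]] := s'P _ si; exists f.
have /choice[w hw] : forall i, exists w, i \in s' ->
    w ** d q = w /\ d q ** f i ** d i ** w = d q.
  move=> i; case si: (i \in s'); last by exists 0.
  have [ni _] := s'P _ si.
  by have [w [_ _ h1 h2]] := minimal_split (mind i ni) mq (hf _ si); exists w.
exists (fun i => d (nth 0%N s' i) ** w (nth 0%N s' i)).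
exists (fun i => f (nth 0%N s' i) ** d (nth 0%N s' i)).
move=> i j ni nj; have [_ qq _] := mq.
have si : nth 0%N s' i \in s' by apply: mem_nth.
have sj : nth 0%N s' j \in s' by apply: mem_nth.
have [nsi _] := s'P _ si; have [nsj _] := s'P _ sj.
rewrite !cmpA -(cmpA _ (d (nth _ _ i)) (d _)) orth // nth_uniq //.
case: eqP => [->|_]; last by rewrite cmpm0 !cmp0m.
by have [h1 h2] := hw _ sj; rewrite -(cmpA _ (w _) (d q)) h1.
Qed.

(** Multiplicities decide whether [x] is a direct summand of [y]. The members of
a decomposition of [x] are placed in [y] one after the other. If [d q] cannot be
placed, all copies of it in [y] factor through the members already placed that
are isomorphic to it, so [y] has fewer copies of [d q] than [x]. *)
Lemma mult_le_summand x y :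
  (forall t (e : hm t t), minimal e -> (mult e x <= mult e y)%N) ->
  exists (f : hm x y) (g : hm y x), g ** f = idm x.
Proof.
move=> xy; have [n [d sd]] := idempotent_splits (cmp1m (idm x)).
have [mind orth sumd] := sd.
have fr : forall q, (q <= n)%N -> frame d q y.
  elim=> [_|q IH qn]; first by exists (fun=> 0), (fun=> 0).
  have [F [G FG]] := IH (ltnW qn); have mq := mind q qn.
  apply: contrapT => nfr.
  have res f g : d q ** g ** residual d q F G ** f ** d q = 0.
    apply/eqP; apply: contraT => h; case: nfr.
    exact: (frame_extend FG mq h).
  have := frame_isotypic sd qn; set s := filter _ _ => /= ss.
  have /(multP _ _ mq)[F' [G' FG']] := leq_trans ss (xy _ _ mq).
  suff : ((size s).+1 <= size s)%N by rewrite ltnn.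
  apply: (steinitz (e := d) (s := s)
    (A := fun a i => d q ** G' a ** F i)
    (B := fun i b => G i ** F' b ** d q) (eps := fun=> d q)).
  - move=> i; rewrite mem_filter mem_index_iota => /andP[_ iq].
    by apply: mind; apply: ltn_trans qn.
  - by move=> a _; case: mq.
  move=> a b sa sb; rewrite -FG' //.
  have := res (F' b) (G' a).
  rewrite cmpBr cmpm1 !cmpBl cmp_sumr !cmp_suml => /subr0_eq->.
  rewrite big_filter big_mkcond /=; apply: eq_bigr => i _.
  case: asboolP => [_|nex]; first by rewrite !cmpA.
  suff -> : d q ** G' a ** (F i ** d i ** G i) = 0 by rewrite !cmp0m.
  rewrite !cmpA -(cmpA (d q)); apply: contrapT => h; apply: nex.
  exists (G' a ** F i); apply: contra_notN h => /eqP->.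
  by rewrite cmp0m.
have [F [G FG]] := fr n (leqnn n).
exists (\sum_(0 <= i < n) F i ** d i), (\sum_(0 <= i < n) d i ** G i).
rewrite cmp_suml -sumd; apply: eq_big_nat => i ni; rewrite cmp_sumr.
have ii : i \in index_iota 0 n by rewrite mem_index_iota.
rewrite (big_rem i ii) /= cmpA FG // eqxx big_seq big1 ?addr0 // => j.
rewrite mem_rem_uniq ?iota_uniq // inE mem_index_iota => /andP[ji nj].
by rewrite cmpA FG // eq_sym (negPf ji).
Qed.

End Semisimple.

(** * Fitting's lemma in rings *)

Section Fitting.
Variable A : pzRingType.
Implicit Types x y z : A.

(** The projection onto the part where [x] is invertible: [y * x] is the
identity there and nilpotent on the complement. *)
Lemma fitting_idempotent x y n :
  GRing.comm x y -> x ^+ n = x ^+ n.+1 * y ->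
  let e := (y * x) ^+ n.+1 in e * e = e /\ (e = 0 -> x ^+ n = 0).
Proof.
move=> xy xn e; set z := y * x.
have xz : x ^+ n * z = x ^+ n by rewrite [RHS]xn exprSr -mulrA xy.
have xzk k : x ^+ n * z ^+ k = x ^+ n.
  by elim: k => [|k IH]; rewrite ?expr0 ?mulr1 // exprS mulrA xz.
have znE : z ^+ n = y ^+ n * x ^+ n by rewrite exprMn_comm //; apply: commr_sym.
have znk k : z ^+ (n + k) = z ^+ n by rewrite exprD znE -mulrA xzk.
split; last by rewrite /e -/z => e0; rewrite -(xzk n.+1) e0 mulr0.
by rewrite /e -/z -exprD -[in RHS]addn1 znk addSn -addnS znk.
Qed.

Lemma nilpotent_unit x n : x ^+ n = 0 -> exists v, v * (1 - x) = 1 /\ (1 - x) * v = 1.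
Proof.
move=> xn; exists (\sum_(i < n) x ^+ i).
have E : (1 - x) * (\sum_(i < n) x ^+ i) = 1.
  by rewrite -opprB mulNr -subrX1 xn sub0r opprK.
split=> //; rewrite -[RHS]E.
apply: commr_sym; apply: commr_sum => i _.
by apply/commr_sym/commrB; [apply: commr1|apply/commr_sym/commrX].
Qed.

(** Zero coefficients at the low end are absorbed into the power [x ^+ j], until
the relation can be divided by an invertible lowest coefficient. *)
Lemma relation_regular x (p : nat -> A) k j :
  (forall i, GRing.comm x (p i)) ->
  (forall i, p i = 0 \/ exists q, p i * q = 1 /\ GRing.comm x q) ->
  (exists q, p k * q = 1 /\ GRing.comm x q) ->
  x ^+ j * (\sum_(0 <= i < k.+1) p i * x ^+ i) = 0 ->
  exists n y, GRing.comm x y /\ x ^+ n = x ^+ n.+1 * y.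
Proof.
elim: k p j => [|k IH] p j cp p0u pk rel.
  have [q [pq cq]] := pk; exists j, 0; split; first exact: commr0.
  by move: rel; rewrite big_nat1 expr0 mulr1 mulr0 -{2}[x ^+ j]mulr1 -pq mulrA
            => ->; rewrite mul0r.
move: rel; rewrite big_nat_recl // expr0 mulr1.
set S := \sum_(0 <= i < k.+1) p i.+1 * x ^+ i.
have -> : \sum_(0 <= i < k.+1) p i.+1 * x ^+ i.+1 = x * S.
  rewrite mulr_sumr; apply: eq_bigr => i _.
  by rewrite exprS mulrA [RHS]mulrA (cp i.+1).
have cS : GRing.comm x S.
  by apply: commr_sum => i _; apply: commrM; [apply: cp|apply: commrX].
case: (p0u 0%N) => [->|[q [pq cq]]] rel.
  apply: (IH (fun i => p i.+1) j.+1) => //.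
  by rewrite exprSr -mulrA -/S -[x * S]add0r.
exists j, (- (S * q)); split; first by apply/commrN/commrM.
have /(congr1 ( *%R^~ q)) := rel; rewrite mulrDr mulrDl -(mulrA _ (p _)) pq mulr1.
rewrite mul0r => /eqP; rewrite addr_eq0 => /eqP{1}->.
by rewrite mulrN exprSr !mulrA.
Qed.

End Fitting.

Section EndRing.
Variables (C : preadditive) (a : C).
Definition End : Type := hm a a.
HB.instance Definition _ := GRing.Zmodule.on End.
Fact End_mulA : associative (fun f g : End => f ** g). Proof. exact: cmpA. Qed.
Fact End_mul1 : left_id (idm a : End) (fun f g : End => f ** g).
Proof. exact: cmp1m. Qed.
Fact End_mulr1 : right_id (idm a : End) (fun f g : End => f ** g).
Proof. exact: cmpm1. Qed.
Fact End_mulDl : left_distributive (fun f g : End => f ** g) +%R.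
Proof. by move=> f g h; apply: cmpDl. Qed.
Fact End_mulDr : right_distributive (fun f g : End => f ** g) +%R.
Proof. by move=> f g h; apply: cmpDr. Qed.
HB.instance Definition _ := GRing.Zmodule_isPzRing.Build End
  End_mulA End_mul1 End_mulr1 End_mulDl End_mulDr.
End EndRing.

(** If [g ** f] is strongly pi-regular, Fitting's lemma gives an idempotent that
is a multiple of it; were this zero, [g ** f] would be nilpotent and
[1 - g ** f] invertible. *)
Lemma pi_regular_idempotent (C : preadditive) (a b : C) (f : hm a b) (g : hm b a) :
  (exists n (y : End a), GRing.comm (g ** f : End a) y /\
    (g ** f : End a) ^+ n = (g ** f : End a) ^+ n.+1 * y) ->
  ~ (exists v : hm a a, v ** (idm a - g ** f) = idm a /\
                        (idm a - g ** f) ** v = idm a) ->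
  exists h : hm b a, idempotent (h ** f) /\ h ** f != 0.
Proof.
set x : End a := g ** f; move=> [n [y [xy xn]]] ninv.
have [ee e0] := fitting_idempotent xy xn.
exists ((((y * x) ^+ n * y : End a) : hm a a) ** g).
have -> : (((y * x) ^+ n * y : End a) : hm a a) ** g ** f = ((y * x) ^+ n.+1 : End a).
  by rewrite -cmpA -/x exprSr mulrA.
split; first exact: ee.
by apply/eqP => /e0 /nilpotent_unit.
Qed.

Local Open Scope classical_set_scope.

(** * Noetherian modules *)

Definition linear_of (R : comNzRingType) (V W : lmodType R) (f : V -> W)
    (lf : linear f) : {linear V -> W} :=
  HB.pack f (GRing.isLinear.Build R V W *:%R f lf).

Section Noetherian.
Variable R : comNzRingType.
Implicit Types V W : lmodType R.

Definition noeth_mod V := forall U : nat -> set V,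
  (forall n, is_submodule (U n)) -> (forall n, U n `<=` U n.+1) ->
  exists N, forall n, (N <= n)%N -> U n `<=` U N.

Lemma submodule0 V (U : set V) : is_submodule U -> U 0.
Proof. by case. Qed.

Lemma submoduleB V (U : set V) x y : is_submodule U -> U x -> U y -> U (x - y).
Proof. by move=> sU Ux Uy; apply: submoduleD => //; apply: submoduleN. Qed.

Lemma submodule_sum V (U : set V) (I : Type) (s : seq I) (P : pred I)
    (F : I -> V) :
  is_submodule U -> (forall i, P i -> U (F i)) -> U (\sum_(i <- s | P i) F i).
Proof.
move=> sU UF; elim/big_ind: _ => //; first exact: submodule0.
by move=> x y; apply: submoduleD.
Qed.

Lemma submodule_image V W (f : {linear V -> W}) (U : set V) :
  is_submodule U -> is_submodule [set f x | x in U].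
Proof.
move=> sU; split; first by exists 0; [apply: submodule0|rewrite linear0].
move=> a _ _ [x Ux <-] [y Uy <-]; exists (a *: x + y); last exact: linearP.
by case: sU => _; apply.
Qed.

Lemma submodule_preimage V W (f : {linear V -> W}) (U : set W) :
  is_submodule U -> is_submodule [set x | U (f x)].
Proof.
move=> [U0 sU]; split; rewrite /= ?linear0 // => a x y /= Ux Uy.
by rewrite linearP; apply: sU.
Qed.

Lemma chain_le V (U : nat -> set V) m n :
  (forall n, U n `<=` U n.+1) -> (m <= n)%N -> U m `<=` U n.
Proof.
move=> UU; elim: n => [|n IH]; first by rewrite leqn0 => /eqP->.
by rewrite leq_eqVlt => /orP[/eqP->//|/IH h]; apply: subset_trans h (UU n).
Qed.

(** A chain is controlled by its images under [f] and by its traces on the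
kernel of [f], which is a quotient of [V']. *)
Lemma noeth_ext V V' W (i : {linear V' -> V}) (f : {linear V -> W}) :
  (forall x, f x = 0 -> exists z, i z = x) ->
  noeth_mod V' -> noeth_mod W -> noeth_mod V.
Proof.
move=> ex nV' nW U sU UU.
have [|n x /=|N1 h1] := nV' (fun n => [set z | U n (i z)]).
- by move=> n; apply: submodule_preimage.
- exact: UU.
have [|n _ /= [x Ux <-]|N2 h2] := nW (fun n => [set f x | x in U n]).
- by move=> n; apply: submodule_image.
- by exists x => //; apply: UU.
exists (maxn N1 N2) => n nN x Ux.
have [n1 n2] : (N1 <= n)%N /\ (N2 <= n)%N by apply/andP; rewrite -geq_max.
have [|y Uy fyx] := h2 n n2 (f x); first by exists x.
have Uy' : U (maxn N1 N2) y by apply: chain_le Uy => //; rewrite leq_maxr.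
have [|z iz] := ex (x - y); first by rewrite linearB fyx subrr.
have := h1 n n1 z; rewrite /= iz => /(_ _) Uxy.
rewrite -[x](subrK y); apply: submoduleD => //.
apply: (chain_le UU (leq_maxl N1 N2)); apply: Uxy.
by apply: submoduleB => //; apply: chain_le Uy' => //; rewrite geq_max n1.
Qed.

Lemma noeth_zero V : (forall x : V, x = 0) -> noeth_mod V.
Proof.
move=> V0 U sU _; exists 0%N => n _ x _.
by rewrite (V0 x); apply: submodule0.
Qed.

Lemma noeth_inj V W (f : {linear V -> W}) :
  injective f -> noeth_mod W -> noeth_mod V.
Proof.
move=> fi; apply: (@noeth_ext V 'rV[R]_0 W (\0 : {linear _ -> V}) f).
  by move=> x fx; exists 0; apply: fi; rewrite fx /= linear0.
by apply: noeth_zero => x; apply/rowP => -[].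
Qed.

Lemma noeth_surj V W (f : {linear V -> W}) :
  surjective f -> noeth_mod V -> noeth_mod W.
Proof.
move=> fs nV; apply: (@noeth_ext W V 'rV[R]_0 f (\0 : {linear W -> _})) => //.
by apply: noeth_zero => x; apply/rowP => -[].
Qed.

Lemma noeth_max V (P : set V -> Prop) (U0 : set V) :
  noeth_mod V -> (forall U, P U -> is_submodule U) -> P U0 ->
  exists U, [/\ P U, U0 `<=` U & forall U', P U' -> U `<=` U' -> U' = U].
Proof.
move=> nV PS PU0; apply: contrapT => nmax.
pose P' U := P U /\ U0 `<=` U.
have [|U [PU U0U]|U [_ hU]] :=
  @dependent_choice _ P' (fun U U' => U `<=` U' /\ U' <> U) U0; first by split.
  apply: contrapT => nex; apply: nmax; exists U; split=> // U' PW UW.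
  apply: contrapT => WU; apply: nex; exists U' => //; split=> //.
  exact: subset_trans UW.
have [||N hN] := nV U.
- by move=> n; apply: PS; case: (hU n) => -[].
- by move=> n; case: (hU n) => _ [].
have [_ [UN]] := hU N; apply; apply/seteqP; split=> //.
exact: hN.
Qed.

Lemma span_sub V (S U : set V) : is_submodule U -> S `<=` U -> span S `<=` U.
Proof. by move=> sU SU x; apply. Qed.

Lemma noeth_fg V : noeth_mod V -> finitely_generated V.
Proof.
move=> nV.
pose P (U : set V) := exists n (v : 'I_n -> V), U = span (range v).
have [||U [[n [v Uv]] _ maxU]] :=
  @noeth_max V P (span (range (fun _ : 'I_1 => 0 : V))) nV.
- by move=> _ [n [v ->]]; apply: span_submodule.
- by exists 1%N, (fun=> 0).
exists n, v; apply/seteqP; split=> // x _.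
pose w (i : 'I_(1 + n)) := match fintype.split i with inl _ => x | inr j => v j end.
have <- : span (range w) = span (range v).
  rewrite -Uv; apply: maxU; first by exists (1 + n)%N, w.
  rewrite Uv; apply: span_sub; first exact: span_submodule.
  move=> _ [i _ <-]; apply: sub_span; exists (rshift 1 i) => //.
  by rewrite /w (unsplitK (inr i : 'I_1 + 'I_n)).
apply: sub_span; exists (lshift n ord0) => //.
by rewrite /w (unsplitK (inl ord0 : 'I_1 + 'I_n)).
Qed.

Hypothesis R_noeth : noetherian R.

Lemma noeth_regular : noeth_mod (R^o : lmodType R).
Proof.
move=> U sU UU; pose I : set R := [set x | exists n, U n x].
have [|k [v Iv]] := R_noeth (I := I).
  split; first by exists 0%N; apply: submodule0.
  move=> a x y [n Ux] [m Uy]; exists (maxn n m).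
  have [_] := sU (maxn n m); apply.
    by apply: chain_le Ux => //; rewrite leq_maxl.
  by apply: chain_le Uy => //; rewrite leq_maxr.
have /choice[n hn] : forall i, exists n, U n (v i).
  by move=> i; have : I (v i) by rewrite Iv; apply: sub_span; exists i.
exists (\max_i n i) => m _ x Ux.
have : I x by exists m.
rewrite Iv; apply: span_sub; first exact: sU.
by move=> _ [i _ <-]; apply: chain_le (hn i) => //; apply: leq_bigmax.
Qed.

Fact row_mx0_linear n : linear (fun v : 'rV[R]_n => row_mx (0 : 'rV[R]_1) v).
Proof. by move=> a u v; rewrite scale_row_mx add_row_mx scaler0 addr0. Qed.

Fact row_first_linear n : linear (fun v : 'rV[R]_n.+1 => v 0 ord0 : R^o).
Proof. by move=> a u v; rewrite !mxE. Qed.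

Lemma noeth_rV n : noeth_mod 'rV[R]_n.
Proof.
elim: n => [|n IH]; first by apply: noeth_zero => x; apply/rowP => -[].
pose i : {linear 'rV[R]_n -> 'rV[R]_(1 + n)} :=
  linear_of (@row_mx0_linear n).
pose f : {linear 'rV[R]_(1 + n) -> R^o} :=
  linear_of (@row_first_linear n).
apply: (noeth_ext (i := i) (f := f)) => // [x fx|]; last exact: noeth_regular.
exists (@rsubmx R 1 1 n x); apply/rowP => j.
case: (@split_ordP 1 n j) => k ->; rewrite [LHS](row_mxEl, row_mxEr).
  rewrite mxE -[RHS]/(x 0 _); rewrite -fx /=; congr (x _ _).
  by apply: val_inj; rewrite /= ord1.
by rewrite mxE.
Qed.

Lemma fg_noeth V : finitely_generated V -> noeth_mod V.
Proof.
move=> [n gV]; have [f fs] := finitely_generated_cover gV.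
exact: (noeth_surj fs (@noeth_rV n)).
Qed.

Lemma fg_sub V W (f : {linear V -> W}) :
  injective f -> finitely_generated W -> finitely_generated V.
Proof. by move=> fi /fg_noeth nW; apply/noeth_fg/(noeth_inj fi). Qed.

(** The kernels of the iterates of [f] form a chain; once it is stationary, the
surjective iterates turn this into injectivity of [f]. *)
Lemma noeth_surj_bij V (f : {linear V -> V}) :
  noeth_mod V -> surjective f -> bijective f.
Proof.
move=> nV fs.
have kerS : forall n, is_submodule [set x | iter n f x = 0].
  elim=> [|n IH].
    by split=> // a x y /= -> ->; rewrite scaler0 addr0.
  have -> : [set x | iter n.+1 f x = 0] = [set x | [set x | iter n f x = 0] (f x)].
    by apply/seteqP; split=> x /=; rewrite -iterS iterSr.
  exact: submodule_preimage.
have [//|n x /= hx|N hN] := nV (fun n => [set x | iter n f x = 0]).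
  by rewrite hx linear0.
have iter_surj n y : exists x, iter n f x = y.
  elim: n y => [|n IH] y; first by exists y.
  by have [x <-] := fs y; have [z <-] := IH x; exists z.
have f0 x : f x = 0 -> x = 0.
  have [z <-] := iter_surj N x; rewrite -iterS.
  exact: (hN N.+1 (leqnSn N) z).
have /choice[g gK] := fs.
exists g => x; last exact: gK.
by apply/eqP; rewrite -subr_eq0; apply/eqP/f0; rewrite linearB gK subrr.
Qed.

End Noetherian.

(** * Local rings and Nakayama's lemma *)

(** The maximal ideal of a local ring, characterized as the ideal of non-units. *)
Record local_ideal (R : comNzRingType) (m : set R) : Prop := LocalIdeal {
  li_ideal : is_ideal m;
  li_proper : ~ m 1;
  li_unit : forall x, ~ m x -> exists y, y * x = 1
}.

Lemma local_ring_ideal (R : comNzRingType) :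
  noetherian R -> local_ring R -> exists m : set R, local_ideal m.
Proof.
move=> nR [m [[mI m1 mmax] muniq]]; exists m; split=> // x nmx.
pose I : set R := [set y | exists a, y = a * x].
have II : is_ideal I.
  split; first by exists 0; rewrite mul0r.
  by move=> a _ _ [b ->] [c ->]; exists (a * b + c); rewrite mulrDl -mulrA.
case: (pselect (I 1)) => [[y ->]|nI1]; first by exists y.
pose P (J : set R) := is_ideal J /\ ~ J 1.
have [||J [[JI J1] IJ maxJ]] := @noeth_max R R^o P I (noeth_regular nR).
- by move=> U [].
- by [].
have Jm : J = m.
  symmetry; apply: muniq; split=> // J' J'I J'1 JJ'.
  exact: maxJ.
by case: nmx; rewrite -Jm; apply: IJ; exists 1; rewrite mul1r.
Qed.

Section Nakayama.
Variables (R : comNzRingType) (m : set R).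
Hypothesis mL : local_ideal m.
Implicit Types M N : lmodType R.

(** The submodule [m M]. *)
Definition max_mul M : set M := span [set y | exists a x, m a /\ y = a *: x].

Lemma max_mul_sub M : is_submodule (@max_mul M).
Proof. exact: span_submodule. Qed.

Lemma max_mulZ M a (x : M) : m a -> max_mul (a *: x).
Proof. by move=> ma; apply: sub_span; exists a, x. Qed.

Lemma max_mul_map M N (f : {linear M -> N}) x : max_mul x -> max_mul (f x).
Proof.
apply: (@span_sub _ _ _ [set x | max_mul (f x)]).
  exact/submodule_preimage/max_mul_sub.
by move=> _ [a [y [ma ->]]] /=; rewrite linearZ; apply: max_mulZ.
Qed.

(** Otherwise [N] lies in a maximal proper submodule [L]. The quotient by [L] is
simple, so [L] contains [m M] and then everything. *)
Lemma nakayama M (N : set M) :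
  noeth_mod M -> is_submodule N -> (forall x, exists2 y, N y & max_mul (x - y)) ->
  forall x, N x.
Proof.
move=> nM sN hN x0; apply: contrapT => nNx0.
pose P (U : set M) := is_submodule U /\ exists x, ~ U x.
have [||L [[sL [x1 Lx1]] NL maxL]] := @noeth_max R M P N nM; first by move=> U [].
  by split=> //; exists x0.
have gen x : ~ L x -> forall z, exists r l, L l /\ z = l + r *: x.
  move=> nLx z; pose L' : set M := [set z | exists r l, L l /\ z = l + r *: x].
  have sL' : is_submodule L'.
    split; first by exists 0, 0; rewrite scale0r addr0; split=> //; case: sL.
    move=> a _ _ [r [l [Ll ->]]] [r' [l' [Ll' ->]]].
    exists (a * r + r'), (a *: l + l'); split; first by case: sL => _; apply.
    by rewrite scalerDr scalerDl scalerA addrACA.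
  apply: contrapT => nL'z; apply: nLx.
  rewrite -(maxL L'); first by exists 1, 0; rewrite scale1r add0r; case: sL.
    by split=> //; exists z.
  by move=> z' Lz; exists 0, z'; rewrite scale0r addr0.
have mL' : @max_mul M `<=` L.
  apply: span_sub => // _ [a [y [ma ->]]]; apply: contrapT => nLay.
  have [r [l [Ll yE]]] := gen _ nLay y.
  have [c hc] : exists c, c * (1 - r * a) = 1.
    apply: (li_unit mL) => m1; apply: (li_proper mL).
    have [_ mD] := li_ideal mL.
    by rewrite -[1](subrK (r * a)) addrC; apply: (mD r a (1 - r * a)).
  apply: nLay; apply: submoduleZ => //.
  rewrite -[y]scale1r -hc -scalerA; apply: submoduleZ => //.
  by rewrite scalerBl scale1r -scalerA {1}yE addrK.
have [y Ny mxy] := hN x1; apply: Lx1; rewrite -[x1](subrK y).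
by apply: submoduleD => //; [apply: mL'|apply: NL].
Qed.

Lemma max_mul_bij M (f : {linear M -> M}) :
  noeth_mod M -> (forall x, max_mul (x - f x)) -> bijective f.
Proof.
move=> nM mf; apply: noeth_surj_bij => // y.
suff [x _ <-] : [set f x | x in setT] y by exists x.
apply: (nakayama nM) y => [|x]; first exact: submodule_image.
by exists (f x); [exists x|apply: mf].
Qed.

End Nakayama.

(** * The category of finitely generated modules modulo its radical *)

Section Hom.
Variable R : comNzRingType.
Implicit Types M N P L : lmodType R.

(** Linear maps are taken as a subtype of the functions, whose module structure
they inherit. *)
Definition linear_pred M N : {pred (M -> N)} := fun f => `[< linear f >].
Arguments linear_pred : clear implicits.

Fact linear_submod_closed M N : submod_closed (linear_pred M N).
Proof.
split=> [|a f g /asboolP lf /asboolP lg]; apply/asboolP => b x y.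
  by rewrite /= scaler0 addr0.
by rewrite !fctE lf lg !scalerDr !scalerA (mulrC b a) addrACA.
Qed.

HB.instance Definition _ M N :=
  GRing.isSubmodClosed.Build R (M -> N) (linear_pred M N)
    (linear_submod_closed M N).

Definition hom M N := {f : M -> N | f \in linear_pred M N}.
HB.instance Definition _ M N := SubChoice.on (hom M N).
HB.instance Definition _ M N := [SubChoice_isSubLmodule of hom M N by <:].

Definition hom_fun M N (f : hom M N) : M -> N := val f.
Coercion hom_fun : hom >-> Funclass.

Fact hom_fun_linear M N (f : hom M N) : linear (hom_fun f).
Proof. by apply/asboolP; apply: (valP f). Qed.
HB.instance Definition _ M N (f : hom M N) :=
  GRing.isLinear.Build R M N *:%R (hom_fun f) (hom_fun_linear f).

Fact hom_of_subproof M N (f : {linear M -> N}) : (f : M -> N) \in linear_pred M N.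
Proof. by apply/asboolP => a x y; rewrite linearP. Qed.
Definition hom_of M N (f : {linear M -> N}) : hom M N :=
  exist _ (f : M -> N) (hom_of_subproof f).

Lemma homP M N (f g : hom M N) : f =1 g -> f = g.
Proof. by move=> fg; apply: val_inj; apply: funext. Qed.

Lemma hom_addE M N (f g : hom M N) x : hom_fun (f + g) x = f x + g x. Proof. by []. Qed.
Lemma hom_oppE M N (f : hom M N) x : hom_fun (- f) x = - f x. Proof. by []. Qed.
Lemma hom_scaleE M N a (f : hom M N) x : hom_fun (a *: f) x = a *: f x.
Proof. by []. Qed.
Lemma hom_sumE M N (I : Type) (s : seq I) (P : pred I) (F : I -> hom M N) x :
  hom_fun (\sum_(i <- s | P i) F i) x = \sum_(i <- s | P i) F i x.
Proof. exact: (big_morph (fun f => hom_fun f x) (fun f g => hom_addE f g x)). Qed.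

Lemma linear_bij_inv M N (f : {linear M -> N}) :
  bijective f -> exists g : {linear N -> M}, cancel f g /\ cancel g f.
Proof.
case=> g fK gK; have lg : linear g.
  by move=> a x y; apply: (can_inj fK); rewrite linearP !gK.
by exists (linear_of lg).
Qed.

Lemma bij_comp2 M N (f : {linear M -> N}) (g : {linear N -> M}) :
  bijective (g \o f) -> bijective (f \o g) -> bijective f.
Proof.
move=> [u uK Ku] [v vK Kv].
exists (u \o g) => x /=; first exact: uK.
have fi : injective f by move=> y z yz; rewrite -(uK y) -(uK z) /= yz.
have [z <-] : exists z, f z = x by exists (g (v x)); apply: Kv.
by have /= -> := uK z.
Qed.
(** The Jacobson radical of the category of modules. Unlike [m Hom], it is
respected by passing between a module and its syzygy. *)
Definition rad M N (f : M -> N) : Prop :=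
  forall g : {linear N -> M}, bijective (fun x => x - g (f x)).

(** If [v] inverts [1 - b a], then [1 + a v b] inverts [1 - a b]. *)
Lemma bij_sub_comp M N (a : {linear M -> N}) (b : {linear N -> M}) :
  bijective (fun x => x - b (a x)) -> bijective (fun y => y - a (b y)).
Proof.
move=> [v vK Kv]; exists (fun y => y + a (v (b y))) => y.
- by rewrite linearB vK subrK.
- have := congr1 a (Kv (b y)); rewrite linearB => h.
  have -> : a (b (y + a (v (b y)))) = a (b y) + a (b (a (v (b y)))).
    by rewrite !linearD.
  by rewrite -[X in _ - (X + _)]h subrK addrK.
Qed.

Lemma rad_compl M N P (f : M -> N) (h : {linear N -> P}) :
  rad f -> rad (h \o f).
Proof. by move=> rf g; apply: (rf (g \o h : {linear N -> M})). Qed.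

Lemma rad_compr M N P (f : {linear N -> P}) (h : {linear M -> N}) :
  rad f -> rad (f \o h).
Proof.
move=> rf g; apply: (@bij_sub_comp _ _ (g \o f : {linear _ -> _}) h).
exact: (rf (h \o g : {linear _ -> _})).
Qed.

Lemma rad0 M N : rad (fun _ : M => 0 : N).
Proof. by move=> g; exists id => x; rewrite linear0 subr0. Qed.

Lemma rad_lin M N a (f : {linear M -> N}) (f' : M -> N) :
  rad f -> rad f' -> rad (fun x => a *: f x + f' x).
Proof.
move=> rf rf' g; pose u : {linear M -> M} := idfun \- ((a \*: g) \o f).
have [|v [uK vK]] := @linear_bij_inv _ _ u; first exact: (rf (a \*: g : {linear _ -> _})).
have [w h1 h2] := rf' (v \o g : {linear _ -> _}).
have E x : x - g (a *: f x + f' x) = u (x - v (g (f' x))).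
  by rewrite linearB vK linearP /u /= opprD addrA.
exists (w \o v) => x /=; first by rewrite E uK; apply: h1.
rewrite E; have /= -> := h2 (v x); exact: vK.
Qed.

Definition rad_set M N : set (hom M N) := [set f | rad (hom_fun f)].

Lemma rad_submodule M N : is_submodule (@rad_set M N).
Proof.
split=> [|a f g rf rg]; first exact: rad0.
exact: (@rad_lin _ _ a (hom_fun f) (hom_fun g) rf rg).
Qed.

(** Morphisms modulo the radical; isomorphisms modulo the radical lift to
isomorphisms ([qpi_iso]), so no information on isomorphism classes is lost. *)
Definition qhom M N : lmodType R := quot_module (@rad_set M N).
Definition qpi M N (f : {linear M -> N}) : qhom M N :=
  quot_pi (@rad_set M N) (hom_of f).

Lemma qpi_eq0 M N (f : {linear M -> N}) : qpi f = 0 <-> rad f.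
Proof.
rewrite /qpi quot_pi_eq0; split=> [|rf]; last exact: sub_span.
by move/(_ _ (@rad_submodule M N)); apply.
Qed.

Lemma qpi_lin M N a (f g h : {linear M -> N}) :
  (forall x, h x = a *: f x + g x) -> qpi h = a *: qpi f + qpi g.
Proof.
move=> hE; rewrite /qpi -linearP; congr quot_pi.
by apply: homP => x; rewrite hom_addE hom_scaleE; apply: hE.
Qed.

Lemma eq_qpi M N (f g : {linear M -> N}) : f =1 g -> qpi f = qpi g.
Proof. by move=> fg; congr quot_pi; apply: homP. Qed.

Lemma qpi_add M N (f g : {linear M -> N}) : qpi (f \+ g) = qpi f + qpi g.
Proof.
by rewrite -[qpi f]scale1r; apply: qpi_lin => x; rewrite scale1r.
Qed.

Lemma qpi_sub M N (f g : {linear M -> N}) : qpi (f \- g) = qpi f - qpi g.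
Proof.
by rewrite addrC -scaleN1r; apply: qpi_lin => x; rewrite scaleN1r addrC.
Qed.

Lemma qpi_sum M N (I : Type) (s : seq I) (F : I -> {linear M -> N})
    (h : {linear M -> N}) :
  (forall x, h x = \sum_(i <- s) F i x) -> qpi h = \sum_(i <- s) qpi (F i).
Proof.
move=> hE; rewrite /qpi -linear_sum; congr quot_pi.
by apply: homP => x; rewrite hom_sumE; apply: hE.
Qed.

Lemma qpiP M N (f g : {linear M -> N}) : qpi f = qpi g <-> rad (f \- g).
Proof.
rewrite -(qpi_eq0 (f \- g)) qpi_sub; split=> [->|/subr0_eq//].
by rewrite subrr.
Qed.

Lemma qpi_surj M N (u : qhom M N) : exists f : {linear M -> N}, qpi f = u.
Proof.
have [f <-] := quot_pi_surj u; exists (hom_fun f).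
by congr quot_pi; apply: homP.
Qed.

Definition qrepr M N (u : qhom M N) : {linear M -> N} := sval (cid (qpi_surj u)).
Lemma qreprK M N (u : qhom M N) : qpi (qrepr u) = u.
Proof. by rewrite /qrepr; case: cid. Qed.

Definition qcomp M N P (u : qhom N P) (v : qhom M N) : qhom M P :=
  qpi (qrepr u \o qrepr v).

Lemma qcomp_pi M N P (f : {linear N -> P}) (g : {linear M -> N}) :
  qcomp (qpi f) (qpi g) = qpi (f \o g).
Proof.
apply/qpiP; have /qpiP rf := qreprK (qpi f); have /qpiP rg := qreprK (qpi g).
set f' := qrepr _ in rf *; set g' := qrepr _ in rg *.
have := @rad_lin _ _ 1 _ _ (rad_compr g' rf) (rad_compl f rg).
congr rad; apply: funext => x /=.
by rewrite scale1r linearB addrA subrK.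
Qed.

Fact qcompA M N P L (u : qhom P L) (v : qhom N P) (w : qhom M N) :
  qcomp u (qcomp v w) = qcomp (qcomp u v) w.
Proof.
by rewrite -(qreprK u) -(qreprK v) -(qreprK w) !qcomp_pi; apply: eq_qpi.
Qed.

Fact qcomp1m M N (u : qhom M N) : qcomp (qpi idfun) u = u.
Proof. by rewrite -(qreprK u) !qcomp_pi; apply: eq_qpi. Qed.

Fact qcompm1 M N (u : qhom M N) : qcomp u (qpi idfun) = u.
Proof. by rewrite -(qreprK u) !qcomp_pi; apply: eq_qpi. Qed.

Lemma qcomp_linl M N P a (u v : qhom N P) (w : qhom M N) :
  qcomp (a *: u + v) w = a *: qcomp u w + qcomp v w.
Proof.
rewrite -(qreprK u) -(qreprK v) -(qreprK w).
rewrite -(@qpi_lin _ _ a _ _ (a \*: qrepr u \+ qrepr v)) // !qcomp_pi.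
exact: qpi_lin.
Qed.

Lemma qcomp_linr M N P a (u : qhom N P) (v w : qhom M N) :
  qcomp u (a *: v + w) = a *: qcomp u v + qcomp u w.
Proof.
rewrite -(qreprK u) -(qreprK v) -(qreprK w).
rewrite -(@qpi_lin _ _ a _ _ (a \*: qrepr v \+ qrepr w)) // !qcomp_pi.
by apply: qpi_lin => x /=; rewrite linearP.
Qed.

Fact qcompDl M N P (u v : qhom N P) (w : qhom M N) :
  qcomp (u + v) w = qcomp u w + qcomp v w.
Proof. by have := qcomp_linl 1 u v w; rewrite !scale1r. Qed.

Fact qcompDr M N P (u : qhom N P) (v w : qhom M N) :
  qcomp u (v + w) = qcomp u v + qcomp u w.
Proof. by have := qcomp_linr 1 u v w; rewrite !scale1r. Qed.

Lemma rad_bij M (f : {linear M -> M}) : qpi f = qpi idfun -> bijective f.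
Proof.
move=> /esym/qpiP/(_ idfun) b; apply: (eq_bij b) => x /=.
by rewrite opprB addrC subrK.
Qed.

Lemma qpi_iso M N (f : {linear M -> N}) (g : {linear N -> M}) :
  qcomp (qpi g) (qpi f) = qpi idfun -> qcomp (qpi f) (qpi g) = qpi idfun ->
  bijective f.
Proof.
by rewrite !qcomp_pi => /rad_bij gf /rad_bij fg; apply: bij_comp2 gf fg.
Qed.

End Hom.

Definition fgcat (R : comNzRingType) : preadditive :=
  @Preadditive (fgModule R) (fun M N => qhom M N) (fun M => qpi idfun)
    (fun M N P => @qcomp R M N P) (fun M N P L => @qcompA R M N P L)
    (fun M N => @qcomp1m R M N) (fun M N => @qcompm1 R M N)
    (fun M N P => @qcompDl R M N P) (fun M N P => @qcompDr R M N P).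

(** * Finiteness and regularity modulo the radical *)
Section FiniteHom.
Variable R : comNzRingType.
Hypothesis R_noeth : noetherian R.
Implicit Types M N : lmodType R.

Lemma noeth_ffun r N : finitely_generated N -> noeth_mod {ffun 'I_r -> N}.
Proof.
move=> [s /finitely_generated_cover[p ps]].
pose f (u : 'rV[R]_(r * s)) : {ffun 'I_r -> N} := [ffun i => p (row i (vec_mx u))].
have lf : linear f.
  by move=> a u v; apply/ffunP => i; rewrite !ffunE !linearP.
apply: (noeth_surj (f := linear_of lf)); last exact: noeth_rV.
move=> g; have /choice[h hg] := ps.
exists (mxvec (\matrix_i h (g i))); apply/ffunP => i.
by rewrite /= /f ffunE mxvecK rowK hg.
Qed.

Lemma noeth_hom M N :
  finitely_generated M -> finitely_generated N -> noeth_mod (hom M N).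
Proof.
move=> [r [v gv]] fN.
pose f (u : hom M N) : {ffun 'I_r -> N} := [ffun i => u (v i)].
have lf : linear f.
  by move=> a u w; apply/ffunP => i; rewrite !ffunE hom_addE hom_scaleE.
apply: (noeth_inj (f := linear_of lf)) (noeth_ffun fN) => u w /= uw.
apply: homP => x; apply/eqP; rewrite -subr_eq0 -hom_oppE -hom_addE; apply/eqP.
have : span (range v) x by rewrite gv.
apply: (@span_sub _ _ _ [set x | hom_fun (u - w) x = 0]).
  split; first by rewrite /= linear0.
  move=> a y z yz0 zz0; apply: etrans (hom_fun_linear (u - w) a y z) _.
  by rewrite yz0 zz0 scaler0 addr0.
move=> _ [i _ <-] /=; have /ffunP/(_ i) := uw; rewrite !ffunE => uwi.
by rewrite hom_addE hom_oppE uwi subrr.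
Qed.

Lemma noeth_qhom M N :
  finitely_generated M -> finitely_generated N -> noeth_mod (qhom M N).
Proof.
move=> fM fN.
apply: (noeth_surj (f := quot_pi (@rad_set R M N))) (noeth_hom fM fN).
exact: quot_pi_surj.
Qed.

(** As the idempotents decrease, their left annihilators increase. If those of
[E n] and [E n.+1] agree, they contain [1 - E n.+1], and then [E n = E n.+1]. *)
Lemma fgcat_dcc : idempotent_dcc (fgcat R).
Proof.
move=> M E idE decE.
pose I n : set (qhom M M) := [set u | (u : hm (p := fgcat R) M M) ** E n = 0].
have sI n : is_submodule (I n).
  split; first exact: cmp0m.
  move=> a u v u0 v0; apply: etrans (qcomp_linl a u v (E n)) _.
  by rewrite [qcomp u _]u0 [qcomp v _]v0 scaler0 addr0.
have [|N hN] := @noeth_qhom M M (fg_sortP M) (fg_sortP M) I sI.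
  move=> n u u0; have [h _] := decE n.
  change ((u : hm (p := fgcat R) M M) ** E n.+1 = 0).
  by rewrite -h cmpA (u0 : (u : hm (p := fgcat R) M M) ** E n = 0) cmp0m.
exists N; have hI : I N.+1 (idm M - E N.+1 : hm (p := fgcat R) M M).
  change ((idm M - E N.+1 : hm (p := fgcat R) M M) ** E N.+1 = 0).
  by rewrite cmpBl cmp1m idE subrr.
have : (idm M - E N.+1 : hm (p := fgcat R) M M) ** E N = 0.
  exact: (hN N.+1 (leqnSn N) _ hI).
by rewrite cmpBl cmp1m => /subr0_eq ->; case: (decE N).
Qed.

Variable m : set R.
Hypothesis mL : local_ideal m.

Lemma max_mul_rad M N (f : {linear M -> N}) :
  finitely_generated M -> (forall x, max_mul m (f x)) -> rad f.
Proof.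
move=> fM mf g.
apply: (max_mul_bij mL (f := idfun \- (g \o f) : {linear M -> M})).
  exact: fg_noeth.
by move=> x /=; rewrite opprB addrC subrK; apply: max_mul_map.
Qed.

(** By Nakayama's lemma, [a *: f] is in the radical for [a] in [m]: Hom groups
modulo the radical are vector spaces over the residue field. *)
Lemma qhom_max0 M N a (u : qhom M N) :
  finitely_generated M -> m a -> a *: u = 0.
Proof.
move=> fM ma; have [f <-] := qpi_surj u.
have -> : a *: qpi f = qpi (a \*: f : {linear M -> N}).
  have q0 : qpi (\0 : {linear M -> N}) = 0 by apply/qpi_eq0/rad0.
  rewrite -[LHS]addr0 -q0; apply/esym/qpi_lin => x.
  by rewrite /= addr0.
by apply/qpi_eq0/max_mul_rad => // x; apply: max_mulZ.
Qed.

End FiniteHom.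

Section Regular.
Variables (R : comNzRingType) (m : set R).
Hypotheses (R_noeth : noetherian R) (mL : local_ideal m).

(** The powers of [x] span a chain of submodules of a Noetherian module, which
makes [x] a root of a monic polynomial; modulo the radical each coefficient is
zero or invertible. *)
Lemma qhom_pi_regular (M : fgModule R) (x : End (M : fgcat R)) :
  exists n (y : End (M : fgcat R)), GRing.comm x y /\ x ^+ n = x ^+ n.+1 * y.
Proof.
set A := End _.
pose sc (a : R) : A := a *: (1 : A) : qhom M M.
have scE (a : R) (u : A) : sc a * u = a *: (u : qhom M M) :> qhom M M.
  have := qcomp_linl a (qpi idfun) 0 (u : qhom M M).
  rewrite !addr0 => h; apply: etrans h _.
  have -> : qcomp 0 (u : qhom M M) = 0 := @cmp0m (fgcat R) M M M u.
  by rewrite addr0 qcomp1m.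
have scEr (a : R) (u : A) : u * sc a = a *: (u : qhom M M) :> qhom M M.
  have := qcomp_linr a (u : qhom M M) (qpi idfun) 0.
  rewrite !addr0 => h; apply: etrans h _.
  have -> : qcomp (u : qhom M M) 0 = 0 := @cmpm0 (fgcat R) M M M u.
  by rewrite addr0 qcompm1.
have cx a : GRing.comm x (sc a) by rewrite /GRing.comm scEr scE.
pose X i : qhom M M := x ^+ i.
pose U n : set (qhom M M) :=
  [set u | exists c : nat -> R, u = \sum_(0 <= i < n) c i *: X i].
have sU n : is_submodule (U n).
  split; first by exists (fun=> 0); rewrite big1 // => i _; rewrite scale0r.
  move=> a u v [c ->] [d ->]; exists (fun i => a * c i + d i).
  rewrite scaler_sumr -big_split /=; apply: eq_bigr => i _.
  by rewrite scalerA -scalerDl.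
have [n u [c ->]|N hN] := noeth_qhom R_noeth (fg_sortP M) (fg_sortP M) sU.
  exists (fun i => if i == n then 0 else c i).
  rewrite big_nat_recr //= eqxx scale0r addr0; apply: eq_big_nat => i /= ni.
  by rewrite (ltn_eqF ni).
have [|c hc] := hN N.+1 (leqnSn N) (X N).
  exists (fun i => (i == N)%:R); rewrite big_nat_recr //= eqxx scale1r.
  by rewrite big_nat big1 ?add0r // => i /= ni; rewrite (ltn_eqF ni) scale0r.
have sc1 : sc 1 = 1 by rewrite /sc scale1r.
apply: (relation_regular (p := fun i => sc (if i == N then 1 else - c i))
          (k := N) (j := 0)) => [i|i||].
- exact: cx.
- set a := (if _ then _ else _).
  case: (pselect (m a)) => ma.
    by left; apply: (qhom_max0 R_noeth mL _ (fg_sortP M) ma).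
  have [b ba] := li_unit mL ma; right; exists (sc b); split; last exact: cx.
  apply: etrans (scE _ _) _; rewrite /sc scalerA mulrC ba.
  exact: scale1r.
- by exists 1; rewrite eqxx sc1 mulr1; split=> //; apply: commr1.
rewrite expr0 mul1r.
have -> : \sum_(0 <= i < N.+1) sc (if i == N then 1 else - c i) * x ^+ i =
    \sum_(0 <= i < N.+1) (if i == N then 1 else - c i) *: X i :> qhom M M.
  by apply: eq_bigr => i _; apply: scE.
rewrite big_nat_recr //= eqxx scale1r hc -big_split /=.
rewrite big_nat big1 // => i /= ni; rewrite (ltn_eqF ni) -scalerDl addNr.
exact: scale0r.
Qed.

(** Outside the radical some [1 - g f] is not bijective, hence not invertible
modulo the radical, and Fitting's lemma applies to [g f]. *)
Lemma fgcat_regular : quasi_regular (fgcat R).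
Proof.
move=> M N f f0; have [f' fE] := qpi_surj (f : qhom M N).
have [g ng] : exists g : {linear N -> M}, ~ bijective (fun x => x - g (f' x)).
  apply: contrapT => nex; case/eqP: f0; rewrite -fE; apply/qpi_eq0 => g.
  by apply: contrapT => nb; apply: nex; exists g.
apply: (pi_regular_idempotent (g := qpi g : hm (p := fgcat R) N M)).
  exact: qhom_pi_regular.
move=> [v []]; have [v' <-] := qpi_surj (v : qhom M M).
have -> : idm M - (qpi g : hm (p := fgcat R) N M) ** f =
    qpi (idfun \- (g \o f') : {linear M -> M}) :> qhom M M.
  by rewrite -fE qpi_sub -qcomp_pi.
by move=> h1 h2; apply: ng; apply: (qpi_iso h1 h2).
Qed.

End Regular.

(** * Lifting along covers *)

Section Lifting.
Variable R : comNzRingType.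
Implicit Types M N P K E : lmodType R.

Lemma linear_rVE n N (p : {linear 'rV[R]_n -> N}) u :
  p u = \sum_i u 0 i *: p (delta_mx 0 i).
Proof.
by rewrite {1}[u]row_sum_delta linear_sum; apply: eq_bigr => i _; rewrite linearZ.
Qed.

Lemma lift_rV n M N (g : {linear M -> N}) (f : {linear 'rV[R]_n -> N}) :
  (forall y, exists x, g x = f y) ->
  exists h : {linear 'rV[R]_n -> M}, forall y, g (h y) = f y.
Proof.
move=> gf; have /choice[v hv] := fun i => gf (delta_mx 0 i).
exists (free_cover v) => x; rewrite linear_sum (linear_rVE f).
by apply: eq_bigr => i _; rewrite linearZ hv.
Qed.

Lemma projective_rV n : projective ('rV[R]_n).
Proof. by move=> M N g f sg; apply: lift_rV => y; apply: sg. Qed.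

Lemma factor_surj M N E (p : {linear M -> N}) (h : {linear M -> E}) :
  surjective p -> (forall x, p x = 0 -> h x = 0) ->
  exists h' : {linear N -> E}, forall x, h' (p x) = h x.
Proof.
move=> sp ph; have /choice[s sK] := sp.
have hs x : h (s (p x)) = h x.
  by apply/eqP; rewrite -subr_eq0 -linearB ph // linearB sK subrr.
have lh : linear (h \o s).
  by move=> a x y; rewrite /= -linearP -(hs (_ + _)) linearP !sK.
by exists (linear_of lh).
Qed.

Lemma factor_inj M N E (i : {linear M -> N}) (h : {linear E -> N}) :
  injective i -> (forall z, exists x, i x = h z) ->
  exists h' : {linear E -> M}, forall z, i (h' z) = h z.
Proof.
move=> ii ih; have /choice[s sK] := ih.
have ls : linear s by move=> a x y; apply: ii; rewrite linearP !sK linearP.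
by exists (linear_of ls).
Qed.

Definition cover M : {linear 'rV[R]_(projT1 (minimal_cover M)) -> M} :=
  projT2 (minimal_cover M).
Definition syzygy_incl M :
  {linear syzygy M -> 'rV[R]_(projT1 (minimal_cover M))} :=
  (val : {linear kernel (cover M) -> _}).

Lemma syzygy_incl_inj M : injective (@syzygy_incl M).
Proof. exact: val_inj. Qed.

Lemma syzygy_ker M y : cover M y = 0 <-> exists x, syzygy_incl M x = y.
Proof.
split=> [y0|[x <-]]; last by have /eqP := valP x.
have yk : y \in ker_pred (cover M) by apply/eqP.
by exists (exist _ y yk).
Qed.

Lemma cover_syzygy M x : cover M (syzygy_incl M x) = 0.
Proof. by apply/syzygy_ker; exists x. Qed.

Lemma cover_surj M : finitely_generated M -> surjective (@cover M).
Proof. by move=> fM; have [] := minimal_coverP fM. Qed.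

Lemma syzygy_exact M :
  finitely_generated M ->
  short_exact (syzygy M) 'rV[R]_(projT1 (minimal_cover M)) M.
Proof.
move=> fM; exists (syzygy_incl M), (cover M); split.
- exact: syzygy_incl_inj.
- exact: syzygy_ker.
- exact: cover_surj.
Qed.

End Lifting.

Section Local.
Variables (R : comNzRingType) (m : set R).
Hypotheses (R_noeth : noetherian R) (mL : local_ideal m).
Implicit Types M N K : lmodType R.

Lemma max_sum (I : Type) (s : seq I) (P : pred I) (F : I -> R) :
  (forall i, P i -> m (F i)) -> m (\sum_(i <- s | P i) F i).
Proof. exact: (@submodule_sum R R^o m I s P F (li_ideal mL)). Qed.

Lemma maxM a b : m a -> m (b * a).
Proof. exact: (submoduleZ b (li_ideal mL)). Qed.

Lemma max_rV n N (p : {linear 'rV[R]_n -> N}) (u : 'rV[R]_n) :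
  (forall i, m (u 0 i)) -> max_mul m (p u).
Proof.
move=> mu; rewrite linear_rVE; apply: submodule_sum => [|i _].
  exact: max_mul_sub.
exact: max_mulZ.
Qed.

(** A kernel element with an invertible coordinate expresses one generator
through the others, against minimality. *)
Lemma minimal_cover_ker M (x : 'rV[R]_(projT1 (minimal_cover M))) i :
  finitely_generated M -> projT2 (minimal_cover M) x = 0 -> m (x 0 i).
Proof.
move=> fM; case: (minimal_cover M) (minimal_coverP fM) x i => n p [/= sp minp] x i px.
apply: contrapT => /(li_unit mL)[y yx].
case: n => [|n] in p sp minp x i px yx *; first by case: i {yx}.
have : generated_by n M; last by move/minp; rewrite ltnn.
exists (fun k => p (delta_mx 0 (lift i k))); set w := fun k => _.
have ss := span_submodule (range w).
apply/seteqP; split=> // z _; have [u <-] := sp z.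
rewrite linear_rVE; apply: submodule_sum => [//|j _]; apply: (submoduleZ _ ss).
case: (unliftP i j) => [k ->|->]; first by apply: sub_span; exists k.
move: px; rewrite linear_rVE (bigD1 i) //= => /eqP; rewrite addr_eq0 => /eqP px.
rewrite -[p _]scale1r -yx -scalerA px; apply: (submoduleZ _ ss).
apply: (submoduleN ss); apply: submodule_sum => [//|k ki]; apply: (submoduleZ _ ss).
case: (unliftP i k) ki => [k' ->|->]; last by rewrite eqxx.
by move=> _; apply: sub_span; exists k'.
Qed.

(** Over a local ring this says that [N] has no non-zero free direct summand. *)
Definition no_unit_form N := forall (f : {linear N -> R^o}) x, m (f x).

Lemma no_unit_form_max N N' n (h : {linear N -> 'rV[R]_n})
    (p : {linear 'rV[R]_n -> N'}) x :
  no_unit_form N -> max_mul m (p (h x)).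
Proof.
move=> nuf; apply: max_rV => i.
pose c (y : N) : R^o := h y 0 i.
have lc : linear c by move=> a y z; rewrite /c linearP !mxE.
exact: (nuf (linear_of lc)).
Qed.

Lemma fg_syzygy M : finitely_generated M -> finitely_generated (syzygy M).
Proof.
move=> fM; have [i [p [ii _ _]]] := syzygy_exact fM.
apply: (fg_sub R_noeth ii); apply: noeth_fg; exact: noeth_rV.
Qed.

Lemma fg_syzygy_iter M l :
  finitely_generated M -> finitely_generated (syzygy_iter l M).
Proof. by move=> fM; elim: l => // l; apply: fg_syzygy. Qed.

(** * Desuspension of endomorphisms *)

(** For a minimal cover of [N] with kernel [K] such that [Ext^1 (N, R) = 0] and
[N] has no free summand, endomorphisms of [K] and of [N] correspond to each other
up to maps that factor through free modules. Those maps are in the radical on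
both sides, so the endomorphism rings agree modulo their radicals. *)
Section Desuspension.
Variables (K N : lmodType R) (n : nat).
Variables (i : {linear K -> 'rV[R]_n}) (p : {linear 'rV[R]_n -> N}).
Hypotheses (i_inj : injective i) (p_surj : surjective p).
Hypothesis ip : forall y, p y = 0 <-> exists x, i x = y.
Hypothesis i_max : forall x k, m (i x 0 k).
Hypothesis i_ext : forall f : {linear K -> R^o},
  exists f' : {linear 'rV[R]_n -> R^o}, forall x, f' (i x) = f x.
Hypothesis N_nuf : no_unit_form N.
Hypotheses (K_fg : finitely_generated K) (N_fg : finitely_generated N).

Definition desuspends (f : {linear K -> K}) (f' : {linear N -> N}) :=
  exists u : {linear 'rV[R]_n -> 'rV[R]_n},
    (forall x, u (i x) = i (f x)) /\ (forall y, p (u y) = f' (p y)).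

Lemma desuspension f : exists f', desuspends f f'.
Proof.
have /choice[F hF] : forall k, exists F : {linear 'rV[R]_n -> R^o},
    forall x, F (i x) = i (f x) 0 k.
  move=> k; pose c x : R^o := i (f x) 0 k.
  have lc : linear c by move=> a y z; rewrite /c !linearP !mxE.
  exact: (i_ext (linear_of lc)).
have lu : linear (fun y => \row_k (F k y : R)).
  by move=> a y z; apply/rowP => k; rewrite !mxE linearP.
have uE x : linear_of lu (i x) = i (f x).
  by apply/rowP => k; rewrite mxE hF.
have [|f' hf'] := @factor_surj _ _ _ _ p (p \o linear_of lu) p_surj.
  move=> y /ip[x <-]; apply: etrans (congr1 p (uE x)) _.
  by apply/ip; exists (f x).
by exists f', (linear_of lu); split=> [|y]; [exact: uE|rewrite hf'].
Qed.

Lemma suspension f' : exists f, desuspends f f'.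
Proof.
have [u hu] := projective_rV (f' \o p) p_surj.
have [|f hf] := @factor_inj _ _ _ _ i (u \o i) i_inj.
  move=> x; have [h _] := ip (u (i x)); apply: h.
  by rewrite hu /= (ip (i x)).2 ?linear0 //; exists x.
by exists f, u; split=> x; rewrite ?hf ?hu.
Qed.

Lemma desuspends_comp f f' g g' :
  desuspends f f' -> desuspends g g' -> desuspends (f \o g) (f' \o g').
Proof.
move=> [u [iu pu]] [v [iv pv]]; exists (u \o v).
by split=> x /=; rewrite ?iv ?iu // pu pv.
Qed.

Lemma desuspends_sub f f' g g' :
  desuspends f f' -> desuspends g g' -> desuspends (f \- g) (f' \- g').
Proof.
move=> [u [iu pu]] [v [iv pv]]; exists (u \- v).
by split=> x /=; rewrite !linearB ?iv ?iu // pu pv.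
Qed.

Lemma desuspends_id : desuspends idfun idfun.
Proof. by exists idfun. Qed.

(** The difference [1 - a'] factors through the free module, and a map from [N]
to a free module has its values in [m] times it. *)
Lemma desuspends_idl a a' : desuspends a a' -> a =1 id -> bijective a'.
Proof.
move=> [u [iu pu]] aid; apply: (max_mul_bij mL (fg_noeth R_noeth N_fg)) => x.
have [|h hh] := @factor_surj _ _ _ _ p (idfun \- u) p_surj.
  by move=> y /ip[z <-] /=; rewrite iu aid subrr.
have -> : x - a' x = p (h x).
  by have [y <-] := p_surj x; rewrite hh /= linearB pu.
exact: no_unit_form_max.
Qed.

(** The difference [1 - a] factors through the inclusion of [K] in the free
module, which has its values in [m] times it. *)
Lemma desuspends_idr a a' : desuspends a a' -> a' =1 id -> bijective a.
Proof.
move=> [u [iu pu]] aid; apply: (max_mul_bij mL (fg_noeth R_noeth K_fg)) => x.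
have [|h hh] := @factor_inj _ _ _ _ i (idfun \- u) i_inj.
  by move=> y; apply/ip; rewrite /= linearB pu aid subrr.
have -> : x - a x = h (i x) by apply: i_inj; rewrite hh /= iu linearB.
exact: max_rV.
Qed.

(** Inverses modulo free modules are carried over, and are inverses up to
bijections by the two preceding lemmas. *)
Lemma desuspends_rad f f' : desuspends f f' -> rad f <-> rad f'.
Proof.
move=> df; split=> rf g.
  have [g0 dg] := suspension g.
  have d1 := desuspends_sub desuspends_id (desuspends_comp dg df).
  have [z [zK Kz]] := linear_bij_inv (rf g0 : bijective (idfun \- (g0 \o f))).
  have [z' dz] := desuspension z.
  apply: (bij_comp2 (f := idfun \- (g \o f')) (g := z')).
    exact: (desuspends_idl (desuspends_comp dz d1) zK).
  exact: (desuspends_idl (desuspends_comp d1 dz) Kz).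
have [g0 dg] := desuspension g.
have d1 := desuspends_sub desuspends_id (desuspends_comp dg df).
have [z' [zK Kz]] := linear_bij_inv (rf g0 : bijective (idfun \- (g0 \o f'))).
have [z dz] := suspension z'.
apply: (bij_comp2 (f := idfun \- (g \o f)) (g := z)).
  exact: (desuspends_idr (desuspends_comp dz d1) zK).
exact: (desuspends_idr (desuspends_comp d1 dz) Kz).
Qed.

Definition orth_family k M := exists e : nat -> {linear M -> M},
  (forall a, (a < k)%N -> qpi (e a) <> 0) /\
  (forall a b, (a < k)%N -> (b < k)%N ->
     qcomp (qpi (e a)) (qpi (e b)) = if a == b then qpi (e a) else 0).

Lemma orth_family_desuspension k : orth_family k K -> orth_family k N.
Proof.
move=> [e [e0 orth]].
have /choice[e' he'] := fun a => desuspension (e a).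
exists e'; split=> [a ka /qpi_eq0/(desuspends_rad (he' a))/qpi_eq0|a b ka kb].
  exact: e0.
have := orth a b ka kb; rewrite !qcomp_pi.
have dab := desuspends_comp (he' a) (he' b).
case: eqP => _.
  by move=> /qpiP/(desuspends_rad (desuspends_sub dab (he' a)))/qpiP.
by move=> /qpi_eq0/(desuspends_rad dab)/qpi_eq0.
Qed.

End Desuspension.
End Local.

(** * Finite injective dimension *)

Section Gorenstein.
Variables (R : comNzRingType) (m : set R).
Hypotheses (R_noeth : noetherian R) (mL : local_ideal m).

(** Dimension shifting along the injective resolution: writing [Z j] for the
kernel of [d j], this is [Ext^1 (Omega^l M, Z j) = 0], obtained from
[Ext^1 (Omega^(l-1) M, Z (j+1)) = 0]. *)
Lemma syzygy_extension (E : nat -> lmodType R)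
    (d : forall j, {linear E j -> E j.+1}) (n : nat) (M : lmodType R) :
  (forall j, injective_module (E j)) ->
  (forall j y, d j.+1 y = 0 <-> exists x, d j x = y) ->
  (forall j, (n < j)%N -> forall y : E j, y = 0) ->
  finitely_generated M ->
  forall l j, (n < l + j)%N ->
  forall f : {linear syzygy_iter l.+1 M -> E j}, (forall x, d j (f x) = 0) ->
  exists f' : {linear 'rV[R]_(projT1 (minimal_cover (syzygy_iter l M))) -> E j},
    (forall y, d j (f' y) = 0) /\ forall x, f' (syzygy_incl _ x) = f x.
Proof.
move=> injE exE zE fM; elim=> [|l IH] j nlj f df.
  by exists (\0 : {linear _ -> _}); split=> x /=; rewrite ?linear0 ?(zE _ nlj (f x)).
set N1 := syzygy_iter l.+1 M; set N0 := syzygy_iter l M.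
have fN1 : finitely_generated N1 by apply: fg_syzygy_iter.
have [g gf] := injE j _ _ (syzygy_incl N1) f (@syzygy_incl_inj _ _).
have [|h hg] := @factor_surj _ _ _ _ (cover N1) (d j \o g) (cover_surj fN1).
  by move=> y /syzygy_ker[x <-]; rewrite /= gf df.
have [||h' [dh' h'h]] := IH j.+1 _ h.
- by rewrite addnS -addSn.
- by move=> x; have [y <-] := cover_surj fN1 x; apply/exE; exists (g y); rewrite hg.
have [|c hc] := @lift_rV _ _ _ _ (d j) h'; first by move=> y; apply/exE.
(* g extends f but need not land in the kernel of d; c repairs this, and it
vanishes on the kernel of the cover *)
exists (g \- (c \o (syzygy_incl N0 \o cover N1))); split=> y.
  by rewrite linearB /= hc h'h hg /= subrr.
apply: etrans (_ : g (syzygy_incl N1 y) -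
  c (syzygy_incl N0 (cover N1 (syzygy_incl N1 y))) = _) => //.
by rewrite gf cover_syzygy linear0 subr0.
Qed.

Lemma gorenstein_extension :
  finite_injective_dimension (R^o : lmodType R) ->
  exists n, forall (M : lmodType R) l, finitely_generated M -> (n <= l)%N ->
  forall f : {linear syzygy_iter l.+1 M -> R^o},
  exists f' : {linear 'rV[R]_(projT1 (minimal_cover (syzygy_iter l M))) -> R^o},
    forall x, f' (syzygy_incl _ x) = f x.
Proof.
move=> [E [eps [d [n [injE ieps ex0 exE zE]]]]]; exists n.+1 => M l fM nl f.
have [||g [dg gf]] := @syzygy_extension E d n M injE exE zE fM l 0%N _ (eps \o f).
- by rewrite addn0.
- by move=> x; apply/ex0; exists (f x).
have [|f' hf'] := @factor_inj _ _ _ _ eps g ieps.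
  by move=> z; apply/ex0.
by exists f' => x; apply: ieps; rewrite hf' gf.
Qed.

(** A linear form on the syzygy extends to the free module, where the syzygy has
its coordinates in [m]. *)
Lemma syzygy_no_unit_form (M : lmodType R) :
  finitely_generated M ->
  (forall f : {linear syzygy M -> R^o},
    exists f' : {linear 'rV[R]_(projT1 (minimal_cover M)) -> R^o},
      forall x, f' (syzygy_incl _ x) = f x) ->
  no_unit_form m (syzygy M).
Proof.
move=> fM ext f x; have [f' <-] := ext f.
rewrite linear_rVE; apply: (max_sum mL) => i _; rewrite [_ *: _]mulrC.
apply: (maxM mL); apply: (minimal_cover_ker mL _ fM).
by apply/syzygy_ker; exists x.
Qed.

End Gorenstein.

(** * Stable equivalence *)

Section Stable.
Variable R : comNzRingType.
Implicit Types X Y Z K L P Q M : lmodType R.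

Definition stably_zero X Y (h : {linear X -> Y}) :=
  exists n (a : {linear X -> 'rV[R]_n}) (b : {linear 'rV[R]_n -> Y}),
    forall x, h x = b (a x).

Definition stably_equivalent X Y :=
  exists (f : {linear X -> Y}) (g : {linear Y -> X}),
    stably_zero (idfun \- (g \o f)) /\ stably_zero (idfun \- (f \o g)).

Lemma stably_zero_ext X Y (h h' : {linear X -> Y}) :
  h =1 h' -> stably_zero h -> stably_zero h'.
Proof. by move=> hh' [n [a [b ab]]]; exists n, a, b => x; rewrite -hh'. Qed.

Lemma stably_zero_comp X Y Z L (f : {linear X -> Y}) (h : {linear Y -> Z})
    (g : {linear Z -> L}) : stably_zero h -> stably_zero (g \o h \o f).
Proof.
by move=> [n [a [b ab]]]; exists n, (a \o f), (g \o b) => x; rewrite /= ab.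
Qed.

Lemma stably_zeroD X Y (h h' : {linear X -> Y}) :
  stably_zero h -> stably_zero h' -> stably_zero (h \+ h').
Proof.
move=> [n [a [b ab]]] [n' [a' [b' ab']]].
have la : linear (fun x => row_mx (a x) (a' x)).
  by move=> k x y; rewrite !linearP scale_row_mx add_row_mx.
have lb : linear (fun u : 'rV[R]_(n + n') => b (lsubmx u) + b' (rsubmx u)).
  by move=> k u v; rewrite !linearP scalerDr addrACA.
exists (n + n')%N, (linear_of la), (linear_of lb) => x /=.
by rewrite row_mxKl row_mxKr ab ab'.
Qed.

Lemma stably_zero0 X Y : stably_zero (\0 : {linear X -> Y}).
Proof.
exists 0%N, (\0 : {linear _ -> _}), (\0 : {linear _ -> _}) => x //.
Qed.

Lemma stably_zero_projective X P Y (a : {linear X -> P}) (b : {linear P -> Y}) :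
  projective P -> finitely_generated P -> stably_zero (b \o a).
Proof.
move=> pP [n /finitely_generated_cover[q sq]].
have [s hs] := pP _ _ q idfun sq.
by exists n, (s \o a), (b \o q) => x; rewrite /= hs.
Qed.

Lemma stable_sym X Y : stably_equivalent X Y -> stably_equivalent Y X.
Proof. by move=> [f [g [h1 h2]]]; exists g, f. Qed.

Lemma stable_iso X Y : isomorphic X Y -> stably_equivalent X Y.
Proof.
move=> [f /linear_bij_inv[g [fK gK]]]; exists f, g; split;
  by apply: (stably_zero_ext _ (stably_zero0 _ _)) => x; rewrite /= ?fK ?gK subrr.
Qed.

Lemma stable_refl X : stably_equivalent X X.
Proof. by apply: stable_iso; exists idfun; exists id. Qed.

Lemma stable_trans Y X Z :
  stably_equivalent X Y -> stably_equivalent Y Z -> stably_equivalent X Z.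
Proof.
move=> [f [g [gf fg]]] [f' [g' [gf' fg']]]; exists (f' \o f), (g \o g'); split.
  apply: stably_zero_ext (stably_zeroD gf (stably_zero_comp f g gf')) => x /=.
  by rewrite linearB addrA subrK.
apply: stably_zero_ext (stably_zeroD fg' (stably_zero_comp g' f' fg)) => x /=.
by rewrite linearB addrA subrK.
Qed.

(** If [1 - a] factors as [b c] through a free module, lift [b] to [b'] with
values in [P]. Then [1 - u - b' c p] maps [P] into [K], and it restricts to
[1 - w] on [K]. *)
Lemma stably_zero_syzygy K P X (i : {linear K -> P}) (p : {linear P -> X})
    (u : {linear P -> P}) (w : {linear K -> K}) (a : {linear X -> X}) :
  injective i -> (forall y, p y = 0 <-> exists x, i x = y) -> surjective p ->
  projective P -> finitely_generated P ->
  (forall y, p (u y) = a (p y)) -> (forall x, i (w x) = u (i x)) ->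
  stably_zero (idfun \- a) -> stably_zero (idfun \- w).
Proof.
move=> ii ip sp pP fP pu iw [n [c [b cb]]].
have [b' hb'] := lift_rV (g := p) (f := b) (fun y => sp (b y)).
have [|D hD] := @factor_inj _ _ _ _ i ((idfun \- u) \- (b' \o c \o p)) ii.
  by move=> y; apply/ip; rewrite /= !linearB hb' -cb /= pu subrr.
apply: stably_zero_ext (stably_zero_projective i D pP fP) => x /=.
apply: ii; rewrite hD /= linearB iw (ip (i x)).2; last by exists x.
by rewrite 2!linear0 subr0.
Qed.

(** Schanuel's lemma in the stable category; with [X] equal to [Y] it says that
syzygies do not depend on the projective cover used. *)
Lemma stable_kernels K P X L Q Y :
  short_exact K P X -> short_exact L Q Y ->
  projective P -> finitely_generated P -> projective Q -> finitely_generated Q ->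
  stably_equivalent X Y -> stably_equivalent K L.
Proof.
move=> [i [p [ii ip sp]]] [j [q [ij jq sq]]] pP fP pQ fQ [f [g [gf fg]]].
have [f1 hf1] := pP _ _ q (f \o p) sq.
have [g1 hg1] := pQ _ _ p (g \o q) sp.
have [|f0 hf0] := @factor_inj _ _ _ _ j (f1 \o i) ij.
  by move=> x; apply/jq; rewrite hf1 /= (ip (i x)).2 ?linear0 //; exists x.
have [|g0 hg0] := @factor_inj _ _ _ _ i (g1 \o j) ii.
  by move=> x; apply/ip; rewrite hg1 /= (jq (j x)).2 ?linear0 //; exists x.
exists f0, g0; split.
  apply: (stably_zero_syzygy (u := g1 \o f1) ii ip sp pP fP _ _ gf) => x /=.
    by rewrite hg1 /= hf1.
  by rewrite hg0 /= hf0.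
apply: (stably_zero_syzygy (u := f1 \o g1) ij jq sq pQ fQ _ _ fg) => x /=.
  by rewrite hf1 /= hg1.
by rewrite hf0 /= hg0.
Qed.

Lemma fg_rV n : finitely_generated ('rV[R]_n).
Proof.
exists n, (fun i => delta_mx 0 i); apply/seteqP; split=> // x _.
rewrite [x]row_sum_delta; apply: submodule_sum => [|i _].
  exact: span_submodule.
by apply: (submoduleZ _ (span_submodule _)); apply: sub_span; exists i.
Qed.

Lemma stable_syzygy_of M' P M :
  finitely_generated M -> projective P -> finitely_generated P ->
  short_exact M' P M -> stably_equivalent (syzygy M) M'.
Proof.
move=> fM pP fP ex; apply: (stable_kernels (syzygy_exact fM) ex) => //.
- exact: projective_rV.
- exact: fg_rV.
- exact: stable_refl.
Qed.

Lemma stable_syzygy X Y :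
  finitely_generated X -> finitely_generated Y ->
  stably_equivalent X Y -> stably_equivalent (syzygy X) (syzygy Y).
Proof.
move=> fX fY; apply: (stable_kernels (syzygy_exact fX) (syzygy_exact fY));
  by [exact: projective_rV|exact: fg_rV].
Qed.

Lemma fg_prod X Y :
  finitely_generated X -> finitely_generated Y -> finitely_generated (X * Y)%type.
Proof. exact: finitely_generated_pair. Qed.

Lemma linear_pair X Y Z (f : {linear Z -> X}) (g : {linear Z -> Y}) :
  linear (fun z => (f z, g z)).
Proof. by move=> a x y; rewrite !linearP. Qed.

Lemma projective_prod P Q : projective P -> projective Q -> projective (P * Q)%type.
Proof.
move=> pP pQ M N g f sg.
have l1 : linear (fun x : P => (x, 0 : Q)).
  by move=> a x y; congr pair; rewrite /= scaler0 addr0.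
have l2 : linear (fun y : Q => (0 : P, y)).
  by move=> a x y; congr pair; rewrite /= scaler0 addr0.
have [h1 gh1] := pP _ _ g (f \o linear_of l1) sg.
have [h2 gh2] := pQ _ _ g (f \o linear_of l2) sg.
exists ((h1 \o fst) \+ (h2 \o snd)) => -[x y] /=.
rewrite linearD gh1 gh2 /= -linearD; congr (f _).
by congr pair; rewrite /= ?addr0 ?add0r.
Qed.

(** A lift of a cover of [M'] to [M] gives, together with [P], a projective
module onto [M] whose kernel is the syzygy of [M']. *)
Lemma stable_extension_projective P M M' :
  finitely_generated M -> finitely_generated M' -> projective P ->
  finitely_generated P -> short_exact P M M' ->
  stably_equivalent (syzygy M) (syzygy M').
Proof.
move=> fM fM' pP fP [i [p [ii ip sp]]].
have [s hs] := projective_rV (g := p) (cover M') sp.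
have [|c hc] := @factor_inj _ _ _ _ i (s \o syzygy_incl M') ii.
  by move=> x; apply/ip; rewrite /= hs; apply/syzygy_ker; exists x.
apply: (@stable_syzygy_of _ (P * 'rV[R]_(projT1 (minimal_cover M')))%type) => //.
- by apply: projective_prod => //; apply: projective_rV.
- by apply: fg_prod => //; apply: fg_rV.
exists (linear_of (linear_pair (\- c) (syzygy_incl M'))).
exists ((i \o fst) \+ (s \o snd)); split.
- by move=> x y /= [_]; apply: syzygy_incl_inj.
- move=> [y z] /=; split=> [e|[x [<- <-]]]; last first.
    by rewrite linearN hc addNr.
  have /syzygy_ker[x xz] : cover M' z = 0.
    move/(congr1 p): e; rewrite linearD linear0 hs (ip (i y)).2 ?add0r //.
    by exists y.
  exists x; apply: etrans (_ : (- c x, syzygy_incl M' x) = _) => //; rewrite xz.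
  congr pair; apply: ii; rewrite linearN hc.
  apply: etrans (_ : - s (syzygy_incl M' x) = _) => //.
  rewrite xz.
  by apply/esym/eqP; rewrite -addr_eq0; apply/eqP.
- move=> x; have [z hz] := cover_surj fM' (p x).
  have [|y hy] := (ip (x - s z)).1; first by rewrite linearB hs hz subrr.
  by exists (y, z); rewrite /= hy subrK.
Qed.

Lemma linear_prod_map X Y X' Y' (f : {linear X -> X'}) (g : {linear Y -> Y'}) :
  linear (fun z : X * Y => (f z.1, g z.2)).
Proof. by move=> a x y; rewrite /= !linearP. Qed.

Lemma stable_syzygy_prod M M' :
  finitely_generated M -> finitely_generated M' ->
  stably_equivalent (syzygy (M * M')%type) (syzygy M * syzygy M')%type.
Proof.
move=> fM fM'.
apply: (@stable_syzygy_of _ ('rV[R]_(projT1 (minimal_cover M)) *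
                             'rV[R]_(projT1 (minimal_cover M')))%type) => //.
- exact: fg_prod.
- by apply: projective_prod; apply: projective_rV.
- by apply: fg_prod; apply: fg_rV.
exists (linear_of (linear_prod_map (syzygy_incl M) (syzygy_incl M'))).
exists (linear_of (linear_prod_map (cover M) (cover M'))); split.
- by move=> [x y] [x' y'] /= [/syzygy_incl_inj-> /syzygy_incl_inj->].
- move=> [y y'] /=; split=> [[/syzygy_ker[x <-] /syzygy_ker[x' <-]]|].
    by exists (x, x').
  by move=> [[x x'] [<- <-]]; congr pair; apply/syzygy_ker; eexists.
- move=> [x x']; have [y <-] := cover_surj fM x; have [y' <-] := cover_surj fM' x'.
  by exists (y, y').
Qed.

End Stable.

(** * Multiplicities of modules *)

Section Multiplicity.
Variables (R : comNzRingType) (m : set R).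
Hypotheses (R_noeth : noetherian R) (mL : local_ideal m).
Local Notation C := (fgcat R).
Let C_reg : quasi_regular C := fgcat_regular R_noeth mL.
Let C_dcc : idempotent_dcc C := fgcat_dcc R_noeth.
Implicit Types T X Y : C.

(** [qpi] with its type expressed in [fgcat], so that the category laws can be
used for rewriting. *)
Definition mor X Y (f : {linear (X : fgModule R) -> (Y : fgModule R)}) : hm X Y := qpi f.

Lemma mor_surj X Y (u : hm X Y) : exists f, mor f = u.
Proof. exact: qpi_surj. Qed.

Lemma mor_comp X Y Z (f : {linear (Y : fgModule R) -> (Z : fgModule R)})
   (g : {linear (X : fgModule R) -> (Y : fgModule R)}) :
  mor f ** mor g = mor (f \o g).
Proof. exact: qcomp_pi. Qed.

Lemma eq_mor X Y (f g : {linear (X : fgModule R) -> (Y : fgModule R)}) :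
  f =1 g -> mor f = mor g.
Proof. exact: eq_qpi. Qed.

Lemma mor_sub X Y (f g : {linear (X : fgModule R) -> (Y : fgModule R)}) :
  mor (f \- g) = mor f - mor g.
Proof. exact: qpi_sub. Qed.

Lemma mor_add X Y (f g : {linear (X : fgModule R) -> (Y : fgModule R)}) :
  mor (f \+ g) = mor f + mor g.
Proof. exact: qpi_add. Qed.

Lemma mor_eq0 X Y (f : {linear (X : fgModule R) -> (Y : fgModule R)}) :
  mor f = 0 <-> rad f.
Proof. exact: qpi_eq0. Qed.

Lemma mor_id X : mor (idfun : {linear (X : fgModule R) -> _}) = idm X.
Proof. by []. Qed.

Lemma fg_biproduct (X Y : fgModule R) : is_biproduct (X : C) (Y : C) (fg_sum X Y : C).
Proof.
have l1 : linear (fun x : X => (x, 0 : Y)).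
  by move=> a x y; congr pair; rewrite /= scaler0 addr0.
have l2 : linear (fun y : Y => (0 : X, y)).
  by move=> a x y; congr pair; rewrite /= scaler0 addr0.
exists (@mor X (fg_sum X Y) (linear_of l1)), (@mor Y (fg_sum X Y) (linear_of l2)).
exists (@mor (fg_sum X Y) X fst), (@mor (fg_sum X Y) Y snd).
split; rewrite ?mor_comp -?mor_id -?mor_add; try exact: eq_mor.
- by apply/mor_eq0; apply: rad0.
- by apply/mor_eq0; apply: rad0.
- by apply: eq_mor => -[x y]; congr pair; rewrite /= ?addr0 ?add0r.
Qed.

Lemma fg_regular : finitely_generated (R^o : lmodType R).
Proof.
exists 1%N, (fun=> 1); apply/seteqP; split=> // x _.
rewrite -[x]mulr1; apply: (submoduleZ (V := R^o) x (span_submodule _)).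
by apply: sub_span; exists ord0.
Qed.

Definition regular : C := FgModule fg_regular.

(** The object cut out by [e] is not a summand of a free module. *)
Definition stable T (e : hm T T) :=
  forall (f : hm T regular) (g : hm regular T), e ** g ** f ** e = 0.

Lemma stable_stably_zero T (e : hm T T) (X Y : fgModule R)
    (h : {linear X -> Y}) (f : hm T (X : C)) (g : hm (Y : C) T) :
  stable e -> stably_zero h -> e ** g ** @mor X Y h ** f ** e = 0.
Proof.
move=> se [n [a [b ab]]].
have la i : linear (fun x => a x 0 i : R^o).
  by move=> k x y; rewrite linearP !mxE.
have lb i : linear (fun r : R^o => r *: b (delta_mx 0 i) : Y).
  by move=> k x y; rewrite scalerDl scalerA.
have -> : @mor X Y h =
    \sum_i @mor regular Y (linear_of (lb i)) ** @mor X regular (linear_of (la i)).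
  under eq_bigr do rewrite mor_comp.
  apply: qpi_sum => x; rewrite ab linear_rVE.
  by apply: eq_bigr => i _.
rewrite cmp_sumr !cmp_suml big1 // => i _.
by have := se (@mor X regular (linear_of (la i)) ** f)
              (g ** @mor regular Y (linear_of (lb i))); rewrite !cmpA.
Qed.

(** Maps through free modules are invisible to a stable [e], so a frame can be
moved along maps that are inverse to each other in the stable category. *)
Lemma mult_stable T (e : hm T T) (X Y : fgModule R) :
  minimal e -> stable e -> stably_equivalent X Y ->
  mult e (X : C) = mult e (Y : C).
Proof.
move=> me se; suff le (X' Y' : fgModule R) :
    stably_equivalent X' Y' -> (mult e (X' : C) <= mult e (Y' : C))%N.
  move=> XY; apply/eqP; rewrite eqn_leq le //=; apply: le.
  exact: stable_sym.
move=> [f [g [gf _]]].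
have /(multP C_reg C_dcc _ _ me)[F [G FG]] := leqnn (mult e (X' : C)).
apply/(multP C_reg C_dcc _ _ me).
exists (fun i => @mor X' Y' f ** F i), (fun i => G i ** @mor Y' X' g).
move=> i j ni nj; rewrite -FG //.
have := stable_stably_zero (F j) (G i) se gf.
rewrite mor_sub cmpBr !cmpBl mor_id cmpm1 -mor_comp !cmpA.
by move/subr0_eq.
Qed.

(** If [e] is not stable and occurs in [N], the composite of maps [R -> N -> R]
through [e] is non-zero modulo the radical; but the second map is a linear form,
with values in [m]. *)
Lemma mult_no_unit_form T (e : hm T T) (N : fgModule R) :
  minimal e -> ~ stable e -> no_unit_form m N -> mult e (N : C) = 0%N.
Proof.
move=> me nse nuf; apply/eqP; rewrite -leqn0 leqNgt; apply/negP.
move=> /(multP C_reg C_dcc _ _ me)[F [G FG]]; have [e0 ee _] := me.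
have [f [g h]] : exists f g, e ** g ** (f : hm T regular) ** e != 0.
  apply: contrapT => nex; apply: nse => f g; apply/eqP; apply: contrapT => /negP h.
  by apply: nex; exists f, g.
have [|w [wf ew]] := minimal_linv C_reg me _ h; first by rewrite -cmpA ee.
have [a ha] := mor_surj (f ** e ** w ** e ** G 0%N : hm (N : C) regular).
have [b hb] := mor_surj (F 0%N ** e ** g : hm regular (N : C)).
have ab0 : mor a ** mor b = 0.
  rewrite mor_comp; apply/mor_eq0/(max_mul_rad R_noeth mL fg_regular) => x /=.
  rewrite -[a (b x)]mulr1; apply: (max_mulZ (1 : R^o)); exact: (nuf a).
case/eqP: e0.
have FG0 : e ** G 0%N ** F 0%N ** e = e := FG 0%N 0%N (ltn0Sn _) (ltn0Sn _).
have -> : e = w ** e ** g ** (mor a ** mor b) ** f ** e.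
  rewrite ha hb.
  have -> : w ** e ** g ** (f ** e ** w ** e ** G 0%N ** (F 0%N ** e ** g)) ** f ** e
     = w ** (e ** g ** f ** e) ** w ** (e ** G 0%N ** F 0%N ** e) ** g ** f ** e.
    by rewrite !cmpA.
  by rewrite FG0 wf ew -[LHS]wf !cmpA.
by rewrite ab0 cmpm0 !cmp0m.
Qed.

Lemma mor_bij (X Y : fgModule R) (f : {linear X -> Y}) (g : {linear Y -> X}) :
  @mor Y X g ** @mor X Y f = idm (X : C) -> bijective (g \o f).
Proof. by rewrite mor_comp; apply: rad_bij. Qed.

(** Equal multiplicities make each module a summand of the other; the resulting
surjections are bijective since modules here are Noetherian. *)
Lemma mult_eq_isomorphic (X Y : fgModule R) :
  (forall T (e : hm T T), minimal e -> mult e (X : C) = mult e (Y : C)) ->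
  isomorphic X Y.
Proof.
move=> XY.
have surj (X' Y' : fgModule R) :
    (forall T (e : hm T T), minimal e -> mult e (X' : C) = mult e (Y' : C)) ->
    exists g : {linear Y' -> X'}, forall x, exists y, g y = x.
  move=> XY'; have [|f [g]] := @mult_le_summand _ C_reg C_dcc (X' : C) (Y' : C).
    by move=> T e me; rewrite XY'.
  have [f' <-] := mor_surj f; have [g' <-] := mor_surj g.
  move=> /mor_bij[u uK Ku]; exists g' => x; exists (f' (u x)); exact: Ku.
have [g sg] := surj X Y XY.
have [|g' sg'] := surj Y X; first by move=> T e me; rewrite XY.
exists g'; apply: (bij_comp2 (g := g)).
  apply: (noeth_surj_bij (fg_noeth R_noeth (fg_sortP X))) => x.
  by have [y <-] := sg x; have [z <-] := sg' y; exists z.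
apply: (noeth_surj_bij (fg_noeth R_noeth (fg_sortP Y))) => x.
by have [y <-] := sg' x; have [z <-] := sg y; exists z.
Qed.

(** If the summand [X] of [Y] is proper, a decomposition of [X] into
indecomposables together with the complement is an orthogonal family of [Y] that
is longer than any orthogonal family of [X]. *)
Lemma summand_isomorphic (X Y : fgModule R) (f : hm (X : C) (Y : C))
    (g : hm (Y : C) (X : C)) :
  g ** f = idm (X : C) -> (forall k, orth_family k Y -> orth_family k X) ->
  isomorphic X Y.
Proof.
move=> gf orth; have [f' fE] := mor_surj f; have [g' gE] := mor_surj g.
case: (eqVneq (f ** g) (idm (Y : C))) => [fg|nfg].
  exists f'; apply: (@qpi_iso _ _ _ f' g').
    by apply: etrans gf; rewrite -fE -gE.
  by apply: etrans fg; rewrite -fE -gE.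
have [n [d sd]] := idempotent_splits C_dcc (cmp1m (idm (X : C))).
have [mind od _] := sd.
have {orth}[|e [e0 oe]] := orth n.+1.
  pose eps a := if (a < n)%N then f ** d a ** g else idm (Y : C) - f ** g.
  have /choice[e he] := fun a => mor_surj (eps a).
  have gfR Z (z : hm (X : C) Z) : z ** g ** f = z by rewrite -cmpA gf cmpm1.
  exists e; split=> [a an|a b an bn].
    rewrite -/(mor _) he /eps; case: ifP => h; last first.
      by move/subr0_eq => h'; case/eqP: nfg.
    move=> h0; have [+ _ _] := mind a h; case/eqP.
    rewrite -[d a]cmp1m -gf -[LHS]cmpm1 -gf.
    by rewrite cmpA -(cmpA g) -(cmpA g) h0 cmpm0 cmp0m.
  have -> : qcomp (qpi (e a)) (qpi (e b)) = eps a ** eps b by rewrite -!he.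
  rewrite -/(mor _) he /eps.
  have lt c : (c < n.+1)%N -> (c < n)%N = false -> c = n.
    by rewrite ltnS leq_eqVlt => /orP[/eqP//|->].
  case ha: (a < n)%N; case hb: (b < n)%N.
  - rewrite !cmpA gfR -(cmpA f) od //; case: eqP => // _.
    by rewrite cmpm0 cmp0m.
  - rewrite cmpBr cmpm1 !cmpA gfR subrr; case: eqP => // ab.
    by rewrite ab hb in ha.
  - rewrite cmpBl cmp1m !cmpA -(cmpA f g f) gf cmpm1 subrr.
    by case: eqP => // ab; rewrite ab hb in ha.
  - rewrite (lt a) // (lt b) // eqxx cmpBl cmp1m cmpBr cmpm1 !cmpA.
    by rewrite -(cmpA f g f) gf cmpm1 subrr subr0.
have : (n.+1 <= n)%N; last by rewrite ltnn.
apply: (frame_bound C_reg (eps := fun a => qpi (e a) : hm (X : C) (X : C)) sd).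
  by move=> a an; apply/eqP/e0.
exists (fun=> idm (X : C)), (fun=> idm (X : C)) => i j ni nj.
by rewrite !cmpm1; apply: oe.
Qed.

End Multiplicity.

(** * Multiplicities of syzygies *)

Section Syzygies.
Variables (R : comNzRingType) (m : set R).
Hypotheses (R_noeth : noetherian R) (mL : local_ideal m).
Local Notation C := (fgcat R).

Definition syz (M : fgModule R) l : fgModule R :=
  FgModule (fg_syzygy_iter R_noeth l (fg_sortP M)).

Lemma stable_syzygy_iter (X Y : lmodType R) l :
  finitely_generated X -> finitely_generated Y -> stably_equivalent X Y ->
  stably_equivalent (syzygy_iter l X) (syzygy_iter l Y).
Proof.
move=> fX fY XY; elim: l => // l IH.
by apply: stable_syzygy => //; apply: fg_syzygy_iter.
Qed.

Lemma stable_syzygy_iter_prod (X Y : lmodType R) l :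
  finitely_generated X -> finitely_generated Y ->
  stably_equivalent (syzygy_iter l (X * Y)%type)
    (syzygy_iter l X * syzygy_iter l Y)%type.
Proof.
move=> fX fY; elim: l => [|l IH]; first exact: stable_refl.
have fXl := fg_syzygy_iter R_noeth l fX; have fYl := fg_syzygy_iter R_noeth l fY.
apply: stable_trans (stable_syzygy_prod fXl fYl).
apply: stable_syzygy => //; last exact: fg_prod.
by apply: fg_syzygy_iter => //; apply: fg_prod.
Qed.

Variables (T : C) (e : hm T T).
Hypotheses (me : minimal e) (se : stable e).

Definition mult_syz (M : fgModule R) l : nat := mult e (syz M l : C).

Lemma mult_syz_iso (M M' : fgModule R) l :
  isomorphic M M' -> mult_syz M l = mult_syz M' l.
Proof.
move=> MM'; apply: (mult_stable R_noeth mL) => //.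
by apply: stable_syzygy_iter; [exact: fg_sortP..|exact: stable_iso].
Qed.

Lemma mult_syz_R1 (P M M' : fgModule R) l :
  projective P -> short_exact P M M' -> mult_syz M l.+1 = mult_syz M' l.+1.
Proof.
move=> pP ex; apply: (mult_stable R_noeth mL) => //.
rewrite /syz /= -!iterS !iterSr; apply: stable_syzygy_iter.
- exact/fg_syzygy/fg_sortP.
- exact/fg_syzygy/fg_sortP.
- by apply: (stable_extension_projective _ _ pP) ex; exact: fg_sortP.
Qed.

Lemma mult_syz_R2 (P M M' : fgModule R) l :
  projective P -> short_exact M' P M -> mult_syz M l.+1 = mult_syz M' l.
Proof.
move=> pP ex; apply: (mult_stable R_noeth mL) => //.
rewrite /syz /= -!iterS !iterSr; apply: stable_syzygy_iter.
- exact/fg_syzygy/fg_sortP.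
- exact: fg_sortP.
- by apply: (stable_syzygy_of _ pP) ex; exact: fg_sortP.
Qed.

Lemma mult_syz_R3 (M M' : fgModule R) l :
  mult_syz (fg_sum M M') l = (mult_syz M l + mult_syz M' l)%N.
Proof.
rewrite /mult_syz.
rewrite -(mult_biproduct (fgcat_regular R_noeth mL) (fgcat_dcc R_noeth) me
           (fg_biproduct _ _)).
apply: (mult_stable R_noeth mL) => //=.
by apply: stable_syzygy_iter_prod; exact: fg_sortP.
Qed.

End Syzygies.

Section GorensteinSyzygies.
Variables (R : comNzRingType) (m : set R).
Hypotheses (R_noeth : noetherian R) (mL : local_ideal m).

(** Beyond the injective dimension [Ext^1 (-, R)] vanishes on syzygies, so these
have no free summands and endomorphisms can be desuspended. *)
Lemma gorenstein_syzygies :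
  finite_injective_dimension (R^o : lmodType R) ->
  exists d, forall (M : fgModule R) l, (d <= l)%N ->
    no_unit_form m (syzygy_iter l M) /\
    forall k, orth_family k (syzygy_iter l.+1 M) -> orth_family k (syzygy_iter l M).
Proof.
move=> /(gorenstein_extension R_noeth)[n ext]; exists n.+1 => M [//|l] nl.
have fM i : finitely_generated (syzygy_iter i M).
  by apply: fg_syzygy_iter => //; apply: fg_sortP.
have nuf : no_unit_form m (syzygy_iter l.+1 M).
  by apply: (syzygy_no_unit_form mL (fM l)); apply: ext => //; apply: fg_sortP.
split=> // k; apply: (orth_family_desuspension R_noeth mL
  (@syzygy_incl_inj _ (syzygy_iter l.+1 M)) (cover_surj (fM l.+1))
  (@syzygy_ker _ (syzygy_iter l.+1 M))) => //.
- move=> x i; apply: (minimal_cover_ker mL) => //.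
  by apply/syzygy_ker; exists x.
- exact: (ext M l.+1 (fg_sortP M) (ltnW nl)).
- exact: (fM l.+2).
Qed.

End GorensteinSyzygies.

(** * Laurent polynomials acting on sequences *)

Section PolyAction.
Implicit Types (p q : {poly int}) (g h : int -> int) (l : int).

(** The variable acts as the shift towards larger indices, in accordance with
[[M] = t [Omega M]] when [g] lists invariants of the successive syzygies. *)
Definition act p g l : int := \sum_(i < size p) p`_i * g (l - i%:Z).

Lemma act_widen n p g l :
  (size p <= n)%N -> act p g l = \sum_(i < n) p`_i * g (l - i%:Z).
Proof.
move=> pn; rewrite /act (big_ord_widen n (fun i => p`_i * g (l - i%:Z)) pn).
rewrite big_mkcond; apply: eq_bigr => i _; case: ltnP => // pi.
by rewrite nth_default ?mul0r.
Qed.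

Lemma actD p q g l : act (p + q) g l = act p g l + act q g l.
Proof.
rewrite !(@act_widen (maxn (size p) (size q))) ?leq_maxl ?leq_maxr ?size_polyD //.
by rewrite -big_split; apply: eq_bigr => i _; rewrite coefD mulrDl.
Qed.

Lemma actC c g l : act c%:P g l = c * g l.
Proof. by rewrite (@act_widen 1) ?size_polyC_leq1 // big_ord1 coefC subr0. Qed.

Lemma actCM c p g l : act (c%:P * p) g l = c * act p g l.
Proof.
rewrite (@act_widen (size p)); last by rewrite mul_polyC size_scale_leq.
by rewrite mulr_sumr; apply: eq_bigr => i _; rewrite coefCM mulrA.
Qed.

Lemma actMX p g l : act (p * 'X) g l = act p g (l - 1).
Proof.
rewrite (@act_widen (size p).+1); last first.
  by rewrite (leq_trans (size_polyMleq _ _)) // size_polyX addn2.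
rewrite big_ord_recl coefMX mul0r add0r; apply: eq_bigr => i _.
by rewrite coefMX /= -addrA -opprD; congr (_ * g (_ - _)).
Qed.

Lemma actMXn p g l n : act (p * 'X^n) g l = act p g (l - n%:Z).
Proof.
elim: n l => [|n IH] l; first by rewrite expr0 mulr1 subr0.
rewrite exprSr mulrA actMX IH -addrA -opprD; congr (act _ _ (_ - _)).
Qed.

Lemma act_shift p g l k : act p (fun j => g (j - k)) l = act p g (l - k).
Proof. by apply: eq_bigr => i _; rewrite addrAC. Qed.

Lemma actM p q g l : act (p * q) g l = act p (act q g) l.
Proof.
elim/poly_ind: p l => [|p c IH] l.
  by rewrite mul0r /act size_poly0 !big_ord0.
rewrite mulrDl mulrAC actD actMX IH actCM actD actMX actC.
by [].
Qed.

Lemma act_sum p (I : Type) (s : seq I) (F : I -> int -> int) l :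
  act p (fun j => \sum_(c <- s) F c j) l = \sum_(c <- s) act p (F c) l.
Proof.
rewrite /act exchange_big /=; apply: eq_bigr => i _; exact: mulr_sumr.
Qed.

Lemma eq_act p g h l : g =1 h -> act p g l = act p h l.
Proof. by move=> gh; apply: eq_bigr => i _; rewrite gh. Qed.

End PolyAction.

Local Notation "p %:F" := (tofrac p).

Section LaurentAction.
Implicit Types (x y : laurent) (g h : int -> int) (l : int).

Lemma laurentP x : exists (p : {poly int}) (k : nat), val x = p%:F / ('X^k)%:F.
Proof. by have /asboolP := valP x. Qed.

(** The value does not depend on the representation as a fraction, by [lactE]. *)
Definition lact x g l : int :=
  let p := cid (laurentP x) in
  let k := cid (svalP p) in act (sval p) g (l + (sval k)%:Z).

Lemma Xn_neq0 k : ('X^k : {poly int})%:F != 0.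
Proof. by rewrite tofrac_eq0 expf_neq0 ?polyX_eq0. Qed.

Lemma lactE x p k g l : val x = p%:F / ('X^k)%:F -> lact x g l = act p g (l + k%:Z).
Proof.
rewrite /lact; case: cid => p' /= h; case: cid => k' /= -> /eqP {h}.
rewrite eqr_div ?Xn_neq0 // -!tofracM tofrac_eq => /eqP pp.
rewrite -[l + k'%:Z](addrK k%:Z) -actMXn pp actMXn.
by rewrite addrAC addrK.
Qed.

Lemma lactD x y g l : lact (x + y) g l = lact x g l + lact y g l.
Proof.
have [p [k xE]] := laurentP x; have [q [j yE]] := laurentP y.
have xyE : val (x + y) = (p * 'X^j + q * 'X^k)%:F / ('X^(k + j))%:F.
  rewrite [LHS](_ : _ = val x + val y) // xE yE addf_div ?Xn_neq0 //.
  by rewrite -!tofracM -tofracD exprD.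
rewrite (lactE _ _ xyE) (lactE _ _ xE) (lactE _ _ yE) actD !actMXn PoszD.
by rewrite !addrA addrK (addrAC l) addrK.
Qed.

Lemma lactM x y g l : lact (x * y) g l = lact x (lact y g) l.
Proof.
have [p [k xE]] := laurentP x; have [q [j yE]] := laurentP y.
have xyE : val (x * y) = (p * q)%:F / ('X^(k + j))%:F.
  rewrite [LHS](_ : _ = val x * val y) // xE yE mulf_div.
  by rewrite -!tofracM exprD.
rewrite (lactE _ _ xyE) actM (lactE _ _ xE).
rewrite PoszD addrA.
have -> : act p (act q g) (l + k%:Z + j%:Z) =
          act p (fun i => act q g (i - - j%:Z)) (l + k%:Z).
  by rewrite act_shift opprK.
by apply: eq_act => i; rewrite opprK (lactE _ _ yE).
Qed.

Lemma lact_poly x p g l : val x = p%:F -> lact x g l = act p g l.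
Proof. by move=> xE; rewrite (@lactE x p 0) ?addr0 // expr0 tofrac1 divr1. Qed.

Lemma lact1 g l : lact 1 g l = g l.
Proof. by rewrite (@lact_poly 1 1%:P) ?actC ?mul1r // tofrac1. Qed.

Lemma lact0 g l : lact 0 g l = 0.
Proof. by rewrite (@lact_poly 0 0%:P) ?actC ?mul0r // tofrac0. Qed.

Lemma lactN x g l : lact (- x) g l = - lact x g l.
Proof. by apply/eqP; rewrite -addr_eq0 -lactD addNr lact0. Qed.

Lemma lact_t n g l : lact (laurent_t ^+ n) g l = g (l - n%:Z).
Proof.
elim: n l => [|n IH] l; first by rewrite expr0 lact1 subr0.
rewrite exprS lactM (@lact_poly laurent_t 'X) //.
by rewrite -['X]mul1r actMX actC mul1r IH -addrA -opprD; congr (g (_ - _)).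
Qed.

Lemma lact_sum x (I : Type) (s : seq I) (F : I -> int -> int) l :
  lact x (fun j => \sum_(c <- s) F c j) l = \sum_(c <- s) lact x (F c) l.
Proof. exact: act_sum. Qed.

(** The bound is chosen before [g] because it has to serve all indecomposable
objects at once. *)
Lemma lact_eventually0 x L :
  exists L', forall g, (forall l, (L <= l)%R -> g l = 0) ->
    forall l, (L' <= l)%R -> lact x g l = 0.
Proof.
have [p [k xE]] := laurentP x; exists (L + (size p)%:Z) => g g0 l Ll.
rewrite (lactE _ _ xE); apply: big1 => i _; rewrite g0 ?mulr0 //.
have ip : (i%:Z <= (size p)%:Z)%R by rewrite lez_nat ltnW.
lia.
Qed.

End LaurentAction.

Section Functional.
Variable K : choiceType.
Implicit Types (u v : {malg laurent[K]}) (phi : K -> int -> int) (l : int).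

(** The Laurent-linear extension of [phi] to the free module. *)
Definition evaluate phi u l : int := \sum_(c <- msupp u) lact (mcoeff c u) (phi c) l.

Lemma evaluate_widen (S : {fset K}) phi u l :
  (msupp u `<=` S)%fset ->
  evaluate phi u l = \sum_(c <- S) lact (mcoeff c u) (phi c) l.
Proof.
move=> uS; apply: big_fset_incl => // c _ cu.
by rewrite mcoeff_outdom // lact0.
Qed.

Lemma evaluate_lin phi a u v l :
  evaluate phi (a *: u + v) l = lact a (evaluate phi u) l + evaluate phi v l.
Proof.
set S := (msupp u `|` msupp v)%fset.
have uS : (msupp u `<=` S)%fset by apply: fsubsetUl.
have vS : (msupp v `<=` S)%fset by apply: fsubsetUr.
rewrite (@evaluate_widen S) ?(@evaluate_widen S phi v) //; last first.
  by apply: fsubset_trans (msuppD_le _ _) _; apply: fsetSU; apply: msuppZ_le.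
have -> : lact a (evaluate phi u) l =
    lact a (fun j => \sum_(c <- S) lact (mcoeff c u) (phi c) j) l.
  by apply: eq_act => j; apply: evaluate_widen.
rewrite lact_sum -big_split; apply: eq_bigr => c _.
by rewrite mcoeffD mcoeffZ lactD lactM.
Qed.

Lemma evaluateU phi c l : evaluate phi << c >> l = phi c l.
Proof. by rewrite /evaluate msuppU oner_eq0 big_seq_fset1 mcoeffUU lact1. Qed.

Lemma evaluateD phi u v l : evaluate phi (u + v) l = evaluate phi u l + evaluate phi v l.
Proof. by rewrite -[u in LHS]scale1r evaluate_lin lact1. Qed.

Lemma evaluateZ phi a u l : evaluate phi (a *: u) l = lact a (evaluate phi u) l.
Proof.
by rewrite -[a *: u]addr0 evaluate_lin /evaluate msupp0 big_seq_fset0 addr0.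
Qed.

Lemma evaluateB phi u v l : evaluate phi (u - v) l = evaluate phi u l - evaluate phi v l.
Proof. by rewrite evaluateD -scaleN1r evaluateZ lactN lact1. Qed.

End Functional.

Section Vanishing.
Variables (R : comNzRingType) (m : set R).
Hypotheses (R_noeth : noetherian R) (mL : local_ideal m).
Local Notation C := (fgcat R).

Definition class_repr (c : isoclasses R) : fgModule R := sval (cid (isoclass_surj c)).

Definition syz_seq (T : C) (e : hm T T) (c : isoclasses R) (l : int) : int :=
  if l is Posz k then (mult_syz R_noeth e (class_repr c) k)%:Z else 0.

Lemma syz_seqE (T : C) (e : hm T T) (M : fgModule R) (l : nat) :
  minimal e -> stable e ->
  syz_seq e (isoclass M) l%:Z = (mult_syz R_noeth e M l)%:Z.
Proof.
move=> me se; rewrite /syz_seq; congr Posz; apply: (mult_syz_iso R_noeth mL) => //.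
by apply/isoclassP; rewrite /class_repr; case: cid.
Qed.

(** Eventually vanishing, with a bound that is uniform in [e]. This uniformity is
what turns an equation in [J R] into isomorphisms from one index on. *)
Definition vanishing : set (J_free R) := [set u | exists L : int,
  forall (T : C) (e : hm T T), minimal e -> stable e ->
    forall l, (L <= l)%R -> evaluate (syz_seq e) u l = 0].

Lemma vanishing_submodule : is_submodule vanishing.
Proof.
split; first by exists 0 => T e _ _ l _; rewrite /evaluate msupp0 big_seq_fset0.
move=> a u v [L hL] [L' hL'].
have [L1 h1] := lact_eventually0 a L.
exists (absz L1 + absz L')%:Z => T e me se l Ll.
rewrite evaluate_lin hL' //; last lia.
by rewrite addr0; apply: h1 => [j Lj|]; [apply: hL|lia].
Qed.

(** The relations hold for multiplicities of syzygies from the first syzygy on,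
where projective modules have disappeared. *)
Lemma J_relation_vanishing : (J_relation (R := R) : set (J_free R)) `<=` vanishing.
Proof.
move=> u ru; exists 1 => T e me se [[//|l]|//] _.
case: ru => [P M M' pP ex|P M M' pP ex|M M'].
- rewrite evaluateB !evaluateU !syz_seqE //.
  by rewrite (mult_syz_R1 R_noeth mL me se _ pP ex) subrr.
- rewrite evaluateB evaluateZ -[laurent_t]expr1 lact_t !evaluateU.
  have -> : Posz l.+1 - 1 = Posz l by lia.
  by rewrite !syz_seqE // (mult_syz_R2 R_noeth mL me se _ pP ex) subrr.
- rewrite !evaluateB !evaluateU !syz_seqE //.
  rewrite (mult_syz_R3 R_noeth mL me se) PoszD; lia.
Qed.

Lemma J_class_annihilated (r : laurent) (M : fgModule R) :
  r *: J_class M = 0 -> exists L : int, forall (T : C) (e : hm T T),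
    minimal e -> stable e -> forall l, (L <= l)%R ->
      lact r (syz_seq e (isoclass M)) l = 0.
Proof.
move=> rM0; have : span (J_relation (R := R)) (r *: gen M).
  by apply/quot_pi_eq0; rewrite linearZ.
move/(span_sub vanishing_submodule J_relation_vanishing) => [L hL].
exists L => T e me se l Ll; rewrite -(hL T e me se l Ll) evaluateZ.
by apply: eq_act => j; rewrite evaluateU.
Qed.

End Vanishing.

(** * Dickson's lemma *)

(** Always continue with an index at which the rest of the sequence is minimal. *)
Lemma monotone_subsequence (a : nat -> nat) : exists s : nat -> nat,
  (forall k, s k < s k.+1)%N /\ forall i j, (i <= j)%N -> (a (s i) <= a (s j))%N.
Proof.
have /choice[low hlow] : forall k, exists i, (k <= i)%N /\
    forall j, (k <= j)%N -> (a i <= a j)%N.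
  move=> k; have ex : exists v, `[< exists2 i, (k <= i)%N & a i = v >].
    by exists (a k); apply/asboolP; exists k.
  case: (ex_minnP ex) => v /asboolP[i ki <-] minv; exists i; split=> // j kj.
  by apply: minv; apply/asboolP; exists j.
pose s k := iter k (fun i => low i.+1) (low 0%N).
exists s; split=> [k|i j ij]; first by have [] := hlow (s k).+1.
have sS k : (s k < s k.+1)%N by have [] := hlow (s k).+1.
have sle : (s i <= s j)%N.
  by apply: (homo_leq leqnn leq_trans) ij => k; apply: ltnW.
have smin k l : (s k <= l)%N -> (a (s k) <= a l)%N.
  case: k => [|k] kl; first by have [_] := hlow 0%N; apply.
  have [h1 h2] := hlow (s k).+1; apply: h2; apply: leq_trans kl; exact: h1.
exact: smin.
Qed.

Lemma dickson (r : nat) (c : nat -> nat -> nat) : exists s : nat -> nat,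
  (forall k, s k < s k.+1)%N /\
  forall q i j, (q < r)%N -> (i <= j)%N -> (c (s i) q <= c (s j) q)%N.
Proof.
elim: r => [|r [s [sS IH]]]; first by exists id; split.
have [u [uS hu]] := monotone_subsequence (fun k => c (s k) r).
have smon i j : (i < j)%N -> (s i < s j)%N.
  by apply: (homo_ltn ltn_trans).
exists (s \o u); split=> [k|q i j]; first exact/smon/uS.
rewrite ltnS leq_eqVlt => /orP[/eqP->|qr] ij /=; first exact: hu.
apply: IH => //; apply: (homo_leq leqnn leq_trans) ij => k; exact/ltnW/uS.
Qed.

(** * Torsion and periodicity *)

Section Periodicity.
Variables (R : comNzRingType) (m : set R).
Hypotheses (R_noeth : noetherian R) (mL : local_ideal m).
Local Notation C := (fgcat R).
Local Notation syz := (syz R_noeth).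

Lemma J_class_syz (M : fgModule R) l :
  J_class M = laurent_t ^+ l *: J_class (syz M l).
Proof.
elim: l => [|l IH].
  rewrite expr0 scale1r /J_class; congr (quot_pi _ _); congr << _ >>.
  by apply/isoclassP; exists idfun; exists id.
rewrite IH exprSr -scalerA; congr (_ *: _).
apply/eqP; rewrite -subr_eq0; apply/eqP; rewrite -linearZ -linearB.
apply/quot_pi_eq0; apply: sub_span.
apply: (@J_R2 R (FgModule (fg_rV R (projT1 (minimal_cover (syz M l)))))
  (syz M l) (syz M l.+1)); first exact: projective_rV.
by apply: syzygy_exact; apply: (fg_sortP (syz M l)).
Qed.

Lemma periodic_annihilated (M : fgModule R) n l :
  isomorphic (syzygy_iter l M) (syzygy_iter (n + l) M) ->
  (laurent_t ^+ n - 1) *: J_class M = 0.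
Proof.
move=> iso; rewrite scalerBl scale1r {2}(J_class_syz M (n + l)).
rewrite {1}(J_class_syz M l) scalerA -exprD /J_class.
have -> : gen (syz M l) = gen (syz M (n + l)).
  by congr << _ >>; apply/isoclassP.
by rewrite subrr.
Qed.

(** Detected on the identity sequence. *)
Lemma laurent_tX_sub1_neq0 n : (0 < n)%N -> laurent_t ^+ n - 1 != 0.
Proof.
move=> n0; apply/eqP => t0; have := lact0 id 0; rewrite -t0 lactD lactN lact1.
by rewrite lact_t; lia.
Qed.

(** The lowest non-zero coefficient of [r] belongs to the highest syzygy in the
relation, so its multiplicities cannot be non-zero on their own. *)
Lemma annihilated_recurrence (r : laurent) (M : fgModule R) :
  r != 0 -> r *: J_class M = 0 -> exists L : nat,
  forall (T : C) (e : hm T T) k, minimal e -> stable e -> (L <= k)%N ->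
    mult e (syz M k : C) != 0%N ->
    exists2 j, (j < k)%N & mult e (syz M j : C) != 0%N.
Proof.
move=> r0 /(J_class_annihilated R_noeth mL)[L hL].
have [p [k rE]] := laurentP r.
have p0 : p != 0.
  by apply: contra_neq r0 => p0; apply: val_inj; rewrite rE p0 tofrac0 mul0r.
have ex : exists i, p`_i != 0 by exists (size p).-1; rewrite -lead_coefE lead_coef_eq0.
case: (ex_minnP ex) => i0 pi0 mini0.
exists (absz L + size p + k)%N => T e x me se Lx mx.
have i0p : (i0 < size p)%N.
  by rewrite ltnNge; apply: contraNN pi0 => h; rewrite nth_default.
apply: contrapT => nex.
have := hL T e me se ((x + i0)%:Z - k%:Z); rewrite (lactE _ _ rE) subrK.
have -> : (L <= (x + i0)%:Z - k%:Z)%R by lia.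
have gE i : (i < size p)%N ->
    syz_seq R_noeth e (isoclass M) ((x + i0)%:Z - i%:Z) =
    (mult e (syz M (x + i0 - i) : C))%:Z.
  by move=> ip; rewrite subzn ?(syz_seqE R_noeth mL) //; lia.
rewrite /act (bigD1 (Ordinal i0p)) //= gE // addnK big1 ?addr0 => [/(_ isT)/eqP|].
  by rewrite mulf_eq0 (negPf pi0) /=; lia.
move=> i ii0; rewrite gE //; case: (ltnP i i0) => [ii|i0i].
  by apply/eqP; rewrite mulf_eq0; apply/orP; left; apply: contraTT ii => pi;
     rewrite -leqNgt; apply: mini0.
have ltx : (x + i0 - i < x)%N.
  have : (i0 != i :> nat) by apply: contraNneq ii0 => ii; apply/eqP/val_inj.
  lia.
case: (eqVneq (mult e (syz M (x + i0 - i) : C)) 0%N) => [->|nz]; first by rewrite mulr0.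
by case: nex; exists (x + i0 - i)%N.
Qed.

Lemma recurrent_support (M : fgModule R) L (T : C) (e : hm T T) :
  (forall k, (L <= k)%N -> mult e (syz M k : C) != 0%N ->
    exists2 j, (j < k)%N & mult e (syz M j : C) != 0%N) ->
  forall k, mult e (syz M k : C) != 0%N ->
  exists2 j, (j < L)%N & mult e (syz M j : C) != 0%N.
Proof.
move=> rec; elim/ltn_ind => k IH mk; case: (ltnP k L) => kL; first by exists k.
by have [j jk mj] := rec k kL mk; apply: IH mj.
Qed.

(** One decomposition of this direct sum lists all indecomposable objects that
occur in the first syzygies. *)
Fixpoint syz_total (M : fgModule R) L : fgModule R :=
  if L is L'.+1 then fg_sum (syz_total M L') (syz M L) else syz M 0.

Lemma mult_syz_total (M : fgModule R) (T : C) (e : hm T T) L j :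
  minimal e -> (j <= L)%N -> mult e (syz M j : C) != 0%N ->
  mult e (syz_total M L : C) != 0%N.
Proof.
move=> me; elim: L j => [|L IH] j; first by rewrite leqn0 => /eqP->.
rewrite leq_eqVlt => jL mj; rewrite /= (mult_biproduct
  (fgcat_regular R_noeth mL) (fgcat_dcc R_noeth) me (fg_biproduct _ _)).
rewrite addn_eq0 negb_and; case/orP: jL => [/eqP <-|jL]; first by rewrite mj orbT.
by rewrite (IH j).
Qed.

(** Only finitely many indecomposable objects occur in the syzygies, so by
Dickson's lemma one syzygy has at most the multiplicities of a later one and is a
direct summand of it. Both have equally long decompositions because the later
one desuspends to the earlier one, hence they are isomorphic. *)
Lemma annihilated_periodic (r : laurent) (M : fgModule R) :
  finite_injective_dimension (R^o : lmodType R) ->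
  r != 0 -> r *: J_class M = 0 -> eventually_periodic M.
Proof.
move=> /(gorenstein_syzygies R_noeth mL)[d hd] r0 rM.
have [L hL] := annihilated_recurrence r0 rM.
have C_reg := fgcat_regular R_noeth mL; have C_dcc := fgcat_dcc R_noeth.
have [n [D sD]] := idempotent_splits C_dcc (cmp1m (idm (syz_total M L : C))).
have [s [sS mon]] := dickson n (fun k q => mult (D q) (syz M (d + k) : C)).
set i := (d + s 0)%N; set j := (d + s 1)%N.
have ij : (i < j)%N by rewrite ltn_add2l; apply: sS.
have [|f [g gf]] := @mult_le_summand _ C_reg C_dcc (syz M i : C) (syz M j : C).
  move=> T e me; case: (pselect (stable e)) => se; last first.
    rewrite (mult_no_unit_form R_noeth mL me se) //.
    by have [] := hd M i (leq_addr _ _).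
  case: (eqVneq (mult e (syz M i : C)) 0%N) => [->//|mi].
  have [k kL mk] := recurrent_support (fun k => @hL T e k me se) mi.
  have mZ := mult_syz_total me (ltnW kL) mk.
  have [q qn eq] := mult_support C_reg C_dcc me sD mZ.
  by rewrite !eq; apply: mon.
exists (j - i)%N, i; rewrite subn_gt0 ij (subnK (ltnW ij)); split=> //.
apply: (@summand_isomorphic _ _ R_noeth mL (syz M i) (syz M j) f g gf) => k.
rewrite /=.
have step l : orth_family k (syzygy_iter (i + l) M) ->
    orth_family k (syzygy_iter i M).
  elim: l => [|l IH]; first by rewrite addn0.
  have dil : (d <= i + l)%N by rewrite -addnA leq_addr.
  by rewrite addnS => ok; apply: IH; have [_] := hd M _ dil; apply.
by rewrite -(subnKC (ltnW ij)); apply: step.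
Qed.

Lemma annihilated_period (M : fgModule R) n :
  finite_injective_dimension (R^o : lmodType R) ->
  (laurent_t ^+ n - 1) *: J_class M = 0 ->
  exists l0, forall l, (l0 <= l)%N ->
    isomorphic (syzygy_iter l M) (syzygy_iter (n + l) M).
Proof.
move=> /(gorenstein_syzygies R_noeth mL)[d hd] /(J_class_annihilated R_noeth mL)[L hL].
exists (d + absz L)%N => l Ll.
apply: (@mult_eq_isomorphic _ _ R_noeth mL (syz M l) (syz M (n + l))) => T e me.
case: (pselect (stable e)) => se; last first.
  have [nuf _] := hd M l ltac:(lia); have [nuf' _] := hd M (n + l)%N ltac:(lia).
  by rewrite !(mult_no_unit_form R_noeth mL me se).
have := hL T e me se (n + l)%:Z; have -> : (L <= (n + l)%:Z)%R by lia.
move=> /(_ isT); rewrite lactD lactN lact1 lact_t.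
have -> : (n + l)%:Z - n%:Z = l%:Z by lia.
rewrite !(syz_seqE R_noeth mL) //.
by move=> /eqP; rewrite subr_eq0 => /eqP[].
Qed.

End Periodicity.

Theorem theorem5p6 (R : comNzRingType) (hR : gorenstein_local R)
    (M : fgModule R) :
  (torsion (J_class M) <-> eventually_periodic M) /\
  (forall n : nat, (1 <= n)%N ->
     ((laurent_t ^+ n - 1) *: J_class M = 0 <->
      exists l0 : nat, forall l : nat, (l0 <= l)%N ->
        isomorphic (syzygy_iter l M) (syzygy_iter (n + l) M))).
Proof.
have [R_noeth R_local R_fid] := hR.
have [m mL] := local_ring_ideal R_noeth R_local.
split; last first.
  move=> n _; split; first exact: (annihilated_period R_noeth mL).
  by move=> [l0 h]; apply: (periodic_annihilated R_noeth (h l0 (leqnn l0))).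
split=> [[r [r0 rM]]|[n [l [n0 iso]]]].
  exact: (annihilated_periodic R_noeth mL R_fid r0 rM).
exists (laurent_t ^+ n - 1); split; first exact: laurent_tX_sub1_neq0.
exact: (periodic_annihilated R_noeth iso).
Qed.
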